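(* Let $n\ge1$ and $0<p<\infty$. Consider the inequality $$\|f\|_{L^p(\mathbb{R}^n)}\,\|g\|_{L^p(\mathbb{R}^n)}\le C_{p,n}\,\sup_{x,y} f(x)g(y)\,|x-y|^{2n/p}$$ for nonnegative $f,g\in L^p(\mathbb{R}^n)$. The minimum constant $C_{p,n}$ for which this inequality holds for all such $f,g$ is obtained for $f=\mathrm{const}\cdot h$ and $g=\mathrm{const}\cdot h$, where $$h(x)=(1+|x|^2)^{-n/p};$$ that is, the inequality holds for all nonnegative $f,g\in L^p(\mathbb{R}^n)$ with a finite smallest constant, and with that constant equality holds when $f=c_1h$ and $g=c_2h$ for constants $c_1,c_2>0$.
   Context: $L^p(\mathbb{R}^n)$ is with respect to Lebesgue measure, with $\|f\|_{L^p}=(\int|f|^p)^{1/p}$ (also for $p<1$). $\sup$ denotes the essential supremum with respect to Lebesgue measure on $\mathbb{R}^n\times\mathbb{R}^n$. All functions are nonnegative. *)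

(* Defs.v *)
From HB Require Import structures.
From mathcomp Require Import all_boot all_order all_algebra.
From mathcomp Require Import all_classical all_reals all_analysis.
From mathcomp Require Import ess_sup_inf.

Set Implicit Arguments.
Unset Strict Implicit.
Unset Printing Implicit Defensive.
Import Order.TTheory GRing.Theory Num.Theory.
Import numFieldNormedType.Exports.

Local Open Scope classical_set_scope.
Local Open Scope ring_scope.

(* R^n is the type of n-tuples of reals; the library equips it with the
   sigma-algebra generated by the n coordinate projections, i.e. the Borel
   sigma-algebra. *)
Notation "''R[' R ]_ n" := (n.-tuple (measurableTypeR R))
  (at level 0, R at level 100, n at level 2, format "''R[' R ]_ n")
  : type_scope.

Section lebesgue_measure_Rn.
Context {R : realType}.
Local Open Scope ereal_scope.

Definition consR n (z : measurableTypeR R * 'R[R]_n) : 'R[R]_n.+1 :=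
  [tuple of z.1 :: z.2].

Lemma measurable_consR n :
  measurable_fun [set: measurableTypeR R * 'R[R]_n] (@consR n).
Proof. exact: measurable_cons. Qed.

Definition unconsR n (t : 'R[R]_n.+1) : measurableTypeR R * 'R[R]_n :=
  (tnth t ord0, [tuple of behead t]).

Lemma measurable_unconsR n : measurable_fun [set: 'R[R]_n.+1] (@unconsR n).
Proof.
apply/measurable_fun_pair; first exact: measurable_tnth.
exact: measurable_behead.
Qed.

Lemma consRK n : cancel (@consR n) (@unconsR n).
Proof. by case=> x t; congr pair; apply/val_inj. Qed.

Section succ.
Context (n : nat) (mu : {sigma_finite_measure set 'R[R]_n -> \bar R}).

Definition lebesgueS := pushforward ((@lebesgue_measure R) \x mu) (@consR n).

Let lebesgueS0 : lebesgueS set0 = 0.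
Proof. by rewrite /lebesgueS /pushforward preimage_set0 measure0. Qed.

Let lebesgueS_ge0 A : 0 <= lebesgueS A.
Proof. by rewrite /lebesgueS /pushforward; apply: measure_ge0. Qed.

Let lebesgueS_sigma_additive : semi_sigma_additive lebesgueS.
Proof.
apply: (@measure_semi_sigma_additive _ _ _
  (pushforward (lebesgue_measure \x mu) (@consR n))).
exact: measurable_consR.
Qed.

HB.instance Definition _ := isMeasure.Build _ _ _ lebesgueS
  lebesgueS0 lebesgueS_ge0 lebesgueS_sigma_additive.

Let lebesgueS_sigma_finite : sigma_finite [set: 'R[R]_n.+1] lebesgueS.
Proof.
have /sigma_finiteP[F [TF ndF Foo]] := sigma_finiteT (@lebesgue_measure R).
have /sigma_finiteP[G [TG ndG Goo]] := sigma_finiteT mu.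
exists (fun k => @unconsR n @^-1` (F k `*` G k)).
  rewrite -preimage_bigcup (_ : \bigcup_k _ = setT) ?preimage_setT//.
  apply/seteqP; split => // -[x t] _.
  have [i _ Fix] : (\bigcup_i F i) x by rewrite -TF.
  have [j _ Gjt] : (\bigcup_j G j) t by rewrite -TG.
  exists (maxn i j) => //; split => /=.
  - by move: x Fix; exact/subsetPset/ndF/leq_maxl.
  - by move: t Gjt; exact/subsetPset/ndG/leq_maxr.
move=> k; have [mF Fk] := Foo k; have [mG Gk] := Goo k; split.
  rewrite -[X in measurable X]setTI; apply: measurable_unconsR => //.
  exact: measurableX.
rewrite /lebesgueS /pushforward -comp_preimage (_ : _ \o _ = id); last first.
  by apply/funext => z /=; exact: consRK.
by rewrite preimage_id product_measure1E// lte_mul_pinfty// ge0_fin_numE.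
Qed.

HB.instance Definition _ := Measure_isSigmaFinite.Build _ _ _ lebesgueS
  lebesgueS_sigma_finite.

End succ.

(* Iterated product of one-dimensional Lebesgue measures; on the one-point
   space R^0 it is the unit point mass. *)
Fixpoint lebesgueRn (n : nat) : {sigma_finite_measure set 'R[R]_n -> \bar R} :=
  if n is n'.+1 then lebesgueS (lebesgueRn n') else dirac [tuple].

Lemma lebesgueRn_box n (A : 'I_n -> set (measurableTypeR R)) :
  (forall i, measurable (A i)) ->
  lebesgueRn n [set t | forall i, A i (tnth t i)] =
  \prod_(i < n) lebesgue_measure (A i).
Proof.
elim: n A => [|n IHn] A mA.
  rewrite big_ord0 /= diracE (_ : (_ \in _) = true) //.
  by apply/mem_set => -[].
rewrite big_ord_recl -(IHn (fun i => A (lift ord0 i)))//=.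
rewrite /lebesgueS /pushforward.
rewrite (_ : _ @^-1` _ =
    A ord0 `*` [set t | forall i, A (lift ord0 i) (tnth t i)]); last first.
  apply/seteqP; split=> [[x t] /= At|[x t] /= [Ax At] i].
    by split=> [|i]; [exact: (At ord0)|move: (At (lift ord0 i)); rewrite tnthS].
  have [->//|i0] := eqVneq i ord0.
  have [j ->] : exists j, i = lift ord0 j.
    by case: (unliftP ord0 i) i0 => [j ->|-> /eqP//]; exists j.
  by rewrite tnthS.
rewrite product_measure1E//.
rewrite (_ : [set t | _] =
    \bigcap_(i in [set: 'I_n]) ((@tnth _ _)^~ i @^-1` A (lift ord0 i))).
  apply: fin_bigcap_measurable => // i _.
  by rewrite -[X in measurable X]setTI; exact: measurable_tnth.
by apply/seteqP; split=> t /= At i => [_|]; exact: At.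
Qed.

End lebesgue_measure_Rn.

Section reversed_inequality.
Context {R : realType}.

Definition enorm n (x : 'R[R]_n) : R :=
  Num.sqrt (\sum_(i < n) (tnth x i : R) ^+ 2).

Definition edist n (x y : 'R[R]_n) : R :=
  Num.sqrt (\sum_(i < n) ((tnth x i : R) - (tnth y i : R)) ^+ 2).

Context (n : nat) (p : R).

Definition Lp_ge0 (f : 'R[R]_n -> R) : Prop :=
  f \in Lfun (lebesgueRn n) p%:E /\ forall x, 0 <= f x.

Definition Lp_norm (f : 'R[R]_n -> R) : \bar R :=
  Lnorm (lebesgueRn n) p%:E (EFin \o f).

Definition ess_sup_weighted (f g : 'R[R]_n -> R) : \bar R :=
  ess_sup (lebesgueRn n \x lebesgueRn n)%E
    (fun z => (f z.1 * g z.2 * edist z.1 z.2 `^ (2 * n%:R / p))%:E).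

Definition holds_with_constant (C : R) : Prop :=
  forall f g : 'R[R]_n -> R, Lp_ge0 f -> Lp_ge0 g ->
  (Lp_norm f * Lp_norm g <= C%:E * ess_sup_weighted f g)%E.

Definition extremizer (x : 'R[R]_n) : R :=
  (1 + enorm x ^+ 2) `^ (- (n%:R / p)).

End reversed_inequality.

(* Main.v *)
Require Import Defs.
From HB Require Import structures.
From mathcomp Require Import all_boot all_order all_algebra.
From mathcomp Require Import all_classical all_reals all_analysis.
From mathcomp Require Import measurable_realfun ess_sup_inf.
From mathcomp Require Import ring lra.
Set Implicit Arguments.
Unset Strict Implicit.
Unset Printing Implicit Defensive.

Import Order.TTheory GRing.Theory Num.Theory.
Import numFieldNormedType.Exports.

Local Open Scope classical_set_scope.
Local Open Scope ring_scope.

(** Replacing f and g by F = f^p and G = g^p, the claim becomes a bound of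
    the product of the integrals of F and G by the square of the integral of
    (1 + |x|^2)^-n, under the hypothesis F(x) G(y) |x - y|^(2n) <= 1 for
    almost all (x, y). This is [conformal_product_le].

    For heights s and t, almost all pairs in the product of A = {F > s} and
    B = {G > t} satisfy |x - y| <= (s t)^(-1/(2n)). The Brunn-Minkowski
    inequality applied to A - B, which up to a null set of pairs lies in a
    ball of that radius, bounds the sum of the radii of the balls having the
    volumes of A and B: r + q <= (s t)^(-1/(2n)) ([radius_sum_le]). So the decreasing radial
    rearrangements of F and G, which keep the integrals
    ([radial_layer_cake]), satisfy f(r) g(q) (r + q)^(2n) <= 1.

    In the logarithmic variables r = e^u and q = e^w, where the volume
    element is n v e^(n u) du with v the volume of the unit ball, this reads

      Phi(u) Gamma(w) <= ((n v) (2 cosh ((u - w) / 2))^-n)^2.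

    The right-hand side is the square of a function of (u - w) / 2, so the
    one-dimensional Prekopa-Leindler inequality bounds the product of the
    integrals of Phi and Gamma by the square of the integral of
    n v (2 cosh u)^-n, and this last integral is that of (1 + |x|^2)^-n
    written in logarithmic polar coordinates ([bubble_massE]).

    Equality holds for multiples of h: the weighted product of h with itself
    is at most 1 because |x - y|^2 <= (1 + |x|^2) (1 + |y|^2), and the
    inequality just obtained shows that its essential supremum is not
    smaller than 1 ([ess_sup_extremizer]). Equality with a positive finite
    right-hand side makes the constant the smallest one.

    Only an essential supremum is controlled, so the Brunn-Minkowski and
    Prekopa-Leindler inequalities are proved under hypotheses that hold for
    almost all pairs of points. They are written with differences x - y and
    without dilations: the weights l and 1 - l enter through the constant of
    the weighted arithmetic-geometric inequality. *)

(** * Affine changes of variable on the line *)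

Section one_dim.
Context {R : realType}.
Local Notation T1 := (measurableTypeR R).
Local Notation leb := (@lebesgue_measure R).

Lemma measurable_affine (c d : R) :
  measurable_fun [set: T1] (fun x : T1 => c * x + d : T1).
Proof. by apply: measurable_funD => //; apply: measurable_funM. Qed.

Lemma lebesgue_measure_affine (c d : R) (A : set T1) : c != 0 -> measurable A ->
  (leb A = `|c|%:E * leb [set x : T1 | A (c * x + d)%R])%E.
Proof.
move=> c0 mA.
have c0' : 0 <= `|c| by [].
pose m0 := mscale (NngNum c0') (pushforward leb (fun x : T1 => c * x + d : T1)).
pose m := m0 (measurable_affine c d).
have E1 : forall X, ocitv X -> leb X = m X.
  move=> _ [[a b]] _ <-.
  rewrite /m /m0 /mscale /= /pushforward lebesgue_measure_itv/= !lte_fin.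
  have [cp|cn|/eqP] := ltgtP 0 c; last by rewrite eq_sym (negbTE c0).
  - rewrite (_ : _ @^-1` _ = `](a - d) / c, (b - d) / c]%classic); last first.
      apply/seteqP; split=> x /=; rewrite !in_itv/=.
        by rewrite ltr_pdivrMr// ler_pdivlMr// ltrBlDr lerBrDr (mulrC x).
      by rewrite ltr_pdivrMr// ler_pdivlMr// ltrBlDr lerBrDr (mulrC x).
    rewrite lebesgue_measure_itv/= lte_fin ltr_pdivrMr// divfK// ltrD2r.
    case: ifP => _; last by rewrite mule0.
    rewrite -!EFinB -EFinM gtr0_norm//; congr EFin; field.
    by rewrite c0.
  - rewrite (_ : _ @^-1` _ = `[(b - d) / c, (a - d) / c[%classic); last first.
      apply/seteqP; split=> x /=; rewrite !in_itv/=.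
        by rewrite ler_ndivrMr// ltr_ndivlMr// ltrBlDr lerBrDr (mulrC x) andbC.
      by rewrite ler_ndivrMr// ltr_ndivlMr// ltrBlDr lerBrDr (mulrC x) andbC.
    rewrite lebesgue_measure_itv/= lte_fin ltr_ndivrMr// divfK// ltrD2r.
    case: ifP => _; last by rewrite mule0.
    rewrite -!EFinB -EFinM ltr0_norm//; congr EFin; field.
    by rewrite c0.
exact: (lebesgue_measure_unique E1).
Qed.


Lemma ge0_integral_affine (c d : R) (f : T1 -> \bar R) : c != 0 ->
  measurable_fun [set: T1] f -> (forall x, 0 <= f x)%E ->
  (\int[leb]_x f x = `|c|%:E * \int[leb]_x f (c * x + d)%R)%E.
Proof.
move=> c0 mf f0.
have c0' : 0 <= `|c| by [].
pose m0 := mscale (NngNum c0') (pushforward leb (fun x : T1 => c * x + d : T1)).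
pose m := m0 (measurable_affine c d).
rewrite (@eq_measure_integral _ _ _ _ m _ f); last first.
  by move=> A mA _; exact: lebesgue_measure_affine.
rewrite ge0_integral_mscale//= ge0_integral_pushforward//.
exact: measurable_affine.
Qed.

End one_dim.

(** * Tonelli and layer-cake formulas *)

Section tonelli.
Context {R : realType}.
Local Notation T1 := (measurableTypeR R).
Local Notation leb := (@lebesgue_measure R).
Local Open Scope ereal_scope.

Lemma ge0_integral_lebesgueRnS n (F : 'R[R]_n.+1 -> \bar R) :
  measurable_fun [set: 'R[R]_n.+1] F -> (forall x, 0 <= F x) ->
  \int[lebesgueRn n.+1]_x F x =
  \int[leb]_a \int[lebesgueRn n]_x F (consR (a, x)).
Proof.
move=> mF F0.
pose m0 := pushforward (leb \x lebesgueRn n) (@consR R n)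
  : {measure set 'R[R]_n.+1 -> \bar R}.
pose m := m0 (@measurable_consR R n).
rewrite (@eq_measure_integral _ _ _ _ m _ F)//.
rewrite ge0_integral_pushforward//; last exact: measurable_consR.
rewrite preimage_setT fubini_tonelli1//.
  by apply: measurableT_comp => //; exact: measurable_consR.
by move=> z; exact: F0.
Qed.

Lemma tonelli_sections d1 d2 (U : measurableType d1) (V : measurableType d2)
    (m1 : {sigma_finite_measure set U -> \bar R})
    (m2 : {sigma_finite_measure set V -> \bar R}) (A : set (U * V)) :
  measurable A ->
  \int[m1]_x m2 (xsection A x) = \int[m2]_y m1 (ysection A y).
Proof.
move=> mA; have := indic_fubini_tonelli m1 m2 mA.
by rewrite indic_fubini_tonelli_FE// indic_fubini_tonelli_GE.
Qed.

Lemma measurable_superlevel d (U : measurableType d) (F : U -> \bar R)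
    (a : \bar R) :
  measurable_fun [set: U] F -> measurable [set x | a < F x].
Proof. by move=> mF; rewrite -[X in measurable X]setTI; apply: measurable_lte. Qed.

Section layer_cake.
Context d (T : measurableType d) (mu : {sigma_finite_measure set T -> \bar R}).

Definition undergraph (F : T -> \bar R) : set (T1 * T) :=
  [set z | (0 < z.1)%R /\ z.1%:E < F z.2].

Lemma measurable_undergraph (F : T -> \bar R) :
  measurable_fun [set: T] F -> measurable (undergraph F).
Proof.
move=> mF; rewrite (_ : undergraph F = [set z | 0%:E < z.1%:E] `&`
  [set z | z.1%:E < F z.2]); last first.
  by apply/seteqP; split=> z [] /=; rewrite lte_fin.
apply: measurableI.
  rewrite -[X in measurable X]setTI; apply: measurable_lte => //.
  by apply/measurable_EFinP; exact: measurable_fst.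
rewrite -[X in measurable X]setTI; apply: measurable_lte => //.
  by apply/measurable_EFinP; exact: measurable_fst.
by apply: measurableT_comp.
Qed.

Lemma measurable_fun_superlevel (F : T -> \bar R) :
  measurable_fun [set: T] F ->
  measurable_fun [set: T1] (fun s : T1 => mu [set x | (0 < s)%R /\ s%:E < F x]).
Proof.
move=> mF; have := measurable_fun_xsection mu (measurable_undergraph mF).
congr (measurable_fun _ _); apply/funext => s/=.
by congr (mu _); apply/seteqP; split=> x; rewrite /xsection/= inE.
Qed.

Lemma ge0_integral_layer_cake (F : T -> \bar R) :
  measurable_fun [set: T] F -> (forall x, 0 <= F x) ->
  \int[mu]_x F x = \int[leb]_s mu [set x | (0 < s)%R /\ s%:E < F x].
Proof.
move=> mF F0; have mU := measurable_undergraph mF.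
rewrite -[RHS]/(\int[leb]_s (mu \o (fun s => [set x | undergraph F (s, x)])) s).
rewrite (_ : (fun s => _) = xsection (undergraph F)); last first.
  by apply/funext => s; apply/seteqP; split=> x; rewrite /xsection/= inE.
rewrite tonelli_sections//; apply: eq_integral => x _ /=.
have := F0 x; case Fx : (F x) => [r| |]// r0.
- rewrite (_ : ysection _ _ = `]0%R, r[%classic).
    rewrite lebesgue_measure_itv/= lte_fin; case: ltP.
      by rewrite sube0.
    by move=> r0'; congr EFin; apply/le_anti/andP; split.
  apply/seteqP; split => s; rewrite /ysection/= inE/undergraph/= Fx in_itv/= lte_fin.
    by case=> /= -> ->.
  by move=> /andP[].
- rewrite (_ : ysection _ _ = `]0%R, +oo[%classic).
    by rewrite lebesgue_measure_itv/= ltry.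
  apply/seteqP; split => s; rewrite /ysection/= inE/undergraph/= Fx in_itv/= ltry ?andbT.
    by case=> ->.
  by [].
Qed.
End layer_cake.
End tonelli.

(** * The Brunn-Minkowski inequality for bounded sets of the line *)

Section brunn_minkowski_1d.
Context {R : realType}.
Local Notation T1 := (measurableTypeR R).
Local Notation leb := (@lebesgue_measure R).
Local Open Scope ereal_scope.

Lemma null_xsections d1 d2 (U : measurableType d1) (V : measurableType d2)
    (m1 : {sigma_finite_measure set U -> \bar R})
    (m2 : {sigma_finite_measure set V -> \bar R}) (N : set (U * V)) :
  measurable N -> (m1 \x m2) N = 0 ->
  let Z := [set x | m2 (xsection N x) != 0] in measurable Z /\ m1 Z = 0.
Proof.
move=> mN N0 Z; have mf := measurable_fun_xsection m2 mN.
have mZ : measurable Z.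
  rewrite -[Z]setTI; exact: (emeasurable_neq measurableT mf 0).
split=> //; have : \int[m1]_x `|m2 (xsection N x)| = 0.
  by rewrite -N0; apply: eq_integral => x _; rewrite gee0_abs.
move=> /(ae_eq_integral_abs m1 measurableT mf).1.
move=> [W [mW W0 ZW]]; apply: (subset_measure0 mZ mW _ W0).
by move=> x /= /eqP Zx; apply: ZW => /= /(_ I).
Qed.

Lemma null_ysections d1 d2 (U : measurableType d1) (V : measurableType d2)
    (m1 : {sigma_finite_measure set U -> \bar R})
    (m2 : {sigma_finite_measure set V -> \bar R}) (N : set (U * V)) :
  measurable N -> (m1 \x m2) N = 0 ->
  let Z := [set y | m1 (ysection N y) != 0] in measurable Z /\ m2 Z = 0.
Proof.
move=> mN N0 Z; have mf := measurable_fun_ysection m1 mN.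
have mZ : measurable Z.
  rewrite -[Z]setTI; exact: (emeasurable_neq measurableT mf 0).
split=> //; have : \int[m2]_x `|m1 (ysection N x)| = 0.
  rewrite -N0 [RHS](tonelli_sections m1 m2 mN).
  by apply: eq_integral => x _; rewrite gee0_abs.
move=> /(ae_eq_integral_abs m2 measurableT mf).1.
move=> [W [mW W0 ZW]]; apply: (subset_measure0 mZ mW _ W0).
by move=> x /= /eqP Zx; apply: ZW => /= /(_ I).
Qed.

Lemma measureD0 d (U : measurableType d) (m : {measure set U -> \bar R})
    (A Z : set U) :
  measurable A -> measurable Z -> m Z = 0 -> m (A `\` Z) = m A.
Proof.
move=> mA mZ Z0; rewrite [RHS](measureDI m mA mZ) [X in _ + X](_ : _ = 0) ?adde0//.
by apply: subset_measure0 Z0; [exact: measurableI| |exact: subIsetr].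
Qed.

Lemma lebesgue_measure_shift (A : set T1) (d : R) : measurable A ->
  leb [set x : T1 | A (x + d)%R] = leb A /\ leb [set x : T1 | A (d - x)%R] = leb A.
Proof.
move=> mA; split.
  rewrite [RHS](lebesgue_measure_affine d (oner_neq0 _) mA) normr1 mul1e.
  by congr (leb _); apply/seteqP; split => x /=; rewrite mul1r.
have N1 : (-1 : R)%R != 0%R by rewrite oppr_eq0 oner_eq0.
rewrite [RHS](lebesgue_measure_affine d N1 mA) normrN1 mul1e.
by congr (leb _); apply/seteqP; split => x /=; rewrite mulN1r addrC.
Qed.

Lemma measurable_preimage_affine (c d : R) (A : set T1) : measurable A ->
  measurable [set x : T1 | A (c * x + d)%R].
Proof.
by move=> mA; rewrite -[X in measurable X]setTI; apply: measurable_affine.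
Qed.

(** For x and y close to the suprema of A and B, the translates x - B and
    A - y lie in C up to null sets and overlap in a short interval only, so
    the measures of A and B add up. Just one x and one y are involved, which
    is why a hypothesis on almost all pairs suffices: they are chosen outside
    the null sets of points with a non-null exceptional section. *)
Lemma brunn_minkowski_bounded (A B C : set T1) (N : set (T1 * T1)) (k : R) :
  measurable A -> measurable B -> measurable C -> measurable N ->
  (leb \x leb) N = 0 ->
  (forall x y, A x -> B y -> ~ N (x, y) -> C (x - y)%R) ->
  (forall x, A x -> (x <= k)%R) -> (forall y, B y -> (y <= k)%R) ->
  0 < leb A -> 0 < leb B -> leb A + leb B <= leb C.
Proof.
move=> mA mB mC mN N0 ABC Ak Bk A0 B0.
have [mZ Z0] := null_xsections mN N0.
have [mW W0] := null_ysections mN N0.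
set Z := [set x | _] in mZ Z0; set W := [set x | _] in mW W0.
have mA' := measurableD mA mZ; have mB' := measurableD mB mW.
have lA' := measureD0 mA mZ Z0; have lB' := measureD0 mB mW W0.
move: lA' lB' mA' mB'.
set A' := A `\` Z; set B' := B `\` W => lA' lB' mA' mB'.
have neA : A' !=set0.
  by apply/set0P/eqP => A'0; move: A0; rewrite -lA' A'0 measure0 ltxx.
have neB : B' !=set0.
  by apply/set0P/eqP => B'0; move: B0; rewrite -lB' B'0 measure0 ltxx.
have hA : has_sup A' by split => //; exists k => x [/Ak].
have hB : has_sup B' by split => //; exists k => x [/Bk].
apply/lee_addgt0Pr => e e0.
have e4 : (0 < e / 4)%R by rewrite divr_gt0.
have [x A'x xA] := sup_adherent e4 hA.
have [y B'y yB] := sup_adherent e4 hB.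
set a := sup A' in xA; set b := sup B' in yB.
pose D1 := [set z : T1 | A' (z + y)%R] `\` [set z : T1 | ysection N y (z + y)%R].
pose D2 := [set z : T1 | B' (x - z)%R] `\` [set z : T1 | xsection N x (x - z)%R].
have mNx : measurable (xsection N x) by exact: measurable_xsection.
have mNy : measurable (ysection N y) by exact: measurable_ysection.
have mshift (S : set T1) (u : R) : measurable S ->
    measurable [set z : T1 | S (z + u)%R] /\
    measurable [set z : T1 | S (u - z)%R].
  move=> mS; split.
    have := measurable_preimage_affine 1 u mS.
    by congr measurable; apply/seteqP; split=> z /=; rewrite mul1r.
  have := measurable_preimage_affine (-1) u mS.
  by congr measurable; apply/seteqP; split=> z /=; rewrite mulN1r addrC.
have Nx0 : leb (xsection N x) = 0.
  by case: A'x => _; rewrite /Z/= => /negP; rewrite negbK => /eqP.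
have Ny0 : leb (ysection N y) = 0.
  by case: B'y => _; rewrite /W/= => /negP; rewrite negbK => /eqP.
have mD1 : measurable D1.
  by apply: measurableD; [exact: (mshift _ _ mA').1|exact: (mshift _ _ mNy).1].
have mD2 : measurable D2.
  by apply: measurableD; [exact: (mshift _ _ mB').2|exact: (mshift _ _ mNx).2].
have lD1 : leb D1 = leb A.
  rewrite measureD0; [|exact: (mshift _ _ mA').1|exact: (mshift _ _ mNy).1|].
    by rewrite -lA'; exact: (lebesgue_measure_shift y mA').1.
  by rewrite -Ny0; exact: (lebesgue_measure_shift y mNy).1.
have lD2 : leb D2 = leb B.
  rewrite measureD0; [|exact: (mshift _ _ mB').2|exact: (mshift _ _ mNx).2|].
    by rewrite -lB'; exact: (lebesgue_measure_shift x mB').2.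
  by rewrite -Nx0; exact: (lebesgue_measure_shift x mNx).2.
have D1C : D1 `<=` C.
  move=> z [A'z Nz]; rewrite -(addrK y z); apply: ABC; [exact: A'z.1|exact: B'y.1|].
  by move=> Nzy; apply: Nz; rewrite /ysection/= inE.
have D2C : D2 `<=` C.
  move=> z [B'z Nz]; rewrite -(subKr x z); apply: ABC; [exact: A'x.1|exact: B'z.1|].
  by move=> Nzy; apply: Nz; rewrite /xsection/= inE.
pose t := (a - b + e / 4)%R.
pose I := `[(a - b - e / 4)%R, t]%classic : set T1.
have D1t z : D1 z -> (z < t)%R.
  move=> [A'z _]; have := sup_upper_bound hA A'z; rewrite -/a /t; lra.
have D2t z : D2 z -> (a - b - e / 4 < z)%R.
  move=> [B'z _]; have := sup_upper_bound hB B'z; rewrite -/b; lra.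
have mI : measurable I by exact: measurable_itv.
rewrite -lD1 -lD2 (measureDI _ mD2 mI) addeA; apply: leeD; last first.
  apply: (@le_trans _ _ (leb I)).
    by apply: le_measure; rewrite ?inE//; exact: measurableI.
  rewrite /I lebesgue_measure_itv/= lte_fin; case: ifP => _; last by rewrite ltW.
  by rewrite -EFinB lee_fin /t; lra.
have mDI : measurable (D2 `\` I) by exact: measurableD.
rewrite -measureU//.
  apply: le_measure; rewrite ?inE//; first exact: measurableU.
  by rewrite subUset; split => // z [/D2C].
apply/seteqP; split => // z [/D1t zt [/D2t tz nIz]]; apply: nIz.
by rewrite /I /= in_itv/= (ltW tz) (ltW zt).
Qed.

End brunn_minkowski_1d.

(** * The Prekopa-Leindler inequality on the line *)

Section real_ineq.
Context {R : realType}.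

(** The best constant in the inequality between the weighted geometric mean
    of X and Y and the sum X + Y, see [amgm_const_le]. *)
Definition amgm_const (l : R) : R := ((1 - l) `^ (1 - l) * l `^ l)^-1.

Lemma amgm_const_le (l X Y : R) : 0 < l < 1 -> 0 < X -> 0 < Y ->
  amgm_const l * (X `^ (1 - l) * Y `^ l) <= X + Y.
Proof.
move=> /andP[l0 l1] X0 Y0; have l1' : 0 < 1 - l by rewrite subr_gt0.
have := @conjugate_powR R ((X / (1 - l)) `^ (1 - l)) ((Y / l) `^ l)
  (1 - l)^-1 l^-1.
rewrite !powR_ge0 !invr_gt0 l0 l1' !invrK subrK -!powRrM !divff ?gt_eqF//.
have XX : 0 < X / (1 - l) by rewrite divr_gt0.
have YY : 0 < Y / l by rewrite divr_gt0.
rewrite !powRr1 ?(ltW XX) ?(ltW YY)// !divfK ?gt_eqF//.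
move=> /(_ isT isT isT isT erefl); apply: le_trans.
have [[X0' Y0'] [l0' l1'']] := ((ltW X0, ltW Y0), (ltW l0, ltW l1')).
rewrite !powRM ?invr_ge0// /amgm_const invfM.
have E a b : 0 <= a -> (a^-1 : R) `^ b = (a `^ b)^-1.
  by move=> a0; rewrite -[a^-1]powR_inv1// -powRrM mulN1r powRN.
rewrite !E// le_eqVlt; apply/orP; left; apply/eqP; ring.
Qed.

End real_ineq.

Section approx.
Context {R : realType}.
Local Notation T1 := (measurableTypeR R).
Local Notation leb := (@lebesgue_measure R).
Local Open Scope ereal_scope.

Lemma measure_lt_approx d (U : measurableType d) (m : {measure set U -> \bar R})
    (F : (set U)^nat) (A : set U) (a : \bar R) :
  (forall k, measurable (F k)) -> nondecreasing_seq F -> A = \bigcup_k F k ->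
  a < m A -> exists k, a < m (F k).
Proof.
move=> mF ndF AF aA; apply: contrapT => /forallNP nF.
have cF : m (F k) @[k --> \oo] --> m A.
  rewrite AF; apply: nondecreasing_cvg_mu => //.
  by apply: bigcupT_measurable.
move: aA; rewrite ltNge => /negP; apply; apply: cvge_to_le cF _.
by apply: nearW => k; rewrite leNgt; apply/negP.
Qed.

Lemma bigcup_truncate d (U : measurableType d) (A : set U) (f : U -> R) :
  A = \bigcup_k (A `&` [set x | (f x <= k%:R)%R]).
Proof.
apply/seteqP; split=> x; last by case=> k _ [].
move=> Ax; exists (Num.Def.trunc (f x)).+1 => //; split=> //=.
exact/ltW/truncnS_gt.
Qed.

Lemma nondecreasing_truncate d (U : measurableType d) (A : set U) (f : U -> R) :
  nondecreasing_seq (fun k : nat => A `&` [set x | (f x <= k%:R)%R]).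
Proof.
move=> m n mn; apply/subsetPset => x [Ax /= xm]; split => //=.
by rewrite (le_trans xm)// ler_nat.
Qed.

(** Heights are measured by a in ]0, 1[ in units of a top height S, so that
    levels of two functions with different suprema can be paired. *)
Definition level d (U : measurableType d) (F : U -> \bar R) (S a : R) : set U :=
  [set x | (0 < a < 1)%R /\ (S * a)%:E < F x].

Lemma level01 d (U : measurableType d) (F : U -> \bar R) (S a : R) :
  (0 < a < 1)%R -> level F S a = [set x | (S * a)%:E < F x].
Proof. by move=> a01; apply/seteqP; split=> x /=; [case|]. Qed.

Lemma levelN01 d (U : measurableType d) (F : U -> \bar R) (S a : R) :
  ~~ (0 < a < 1)%R -> level F S a = set0.
Proof. by move=> a01; apply/seteqP; split=> x // []; rewrite (negbTE a01). Qed.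

Lemma measurable_level d (U : measurableType d) (F : U -> \bar R) (S a : R) :
  measurable_fun [set: U] F -> measurable (level F S a).
Proof.
move=> mF; have [a01|a01] := boolP (0 < a < 1)%R; last by rewrite levelN01.
by rewrite level01//; exact: measurable_superlevel.
Qed.

(** The top height S is the essential supremum of F cut off at some k: the
    cut-off makes it finite and k is so large that the part of the integral
    below k still exceeds s. Levels under the essential supremum are not
    null, which the Brunn-Minkowski inequality requires. *)
Lemma level_decomposition d (U : measurableType d)
    (mu : {sigma_finite_measure set U -> \bar R}) (F : U -> \bar R) (s : R) :
  measurable_fun [set: U] F -> (forall x, 0 <= F x) ->
  (0 < s)%R -> s%:E < \int[mu]_x F x ->
  exists S : R, [/\ (0 < S)%R,
    forall a : R, (0 < a < 1)%R -> 0 < mu (level F S a),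
    measurable_fun [set: T1] (fun a : T1 => mu (level F S a)) &
    s%:E < S%:E * \int[leb]_a mu (level F S a)].
Proof.
move=> mF F0 s0; have mU := measurable_undergraph mF.
set V := undergraph F in mU.
have xV a : xsection V a = [set x | (0 < a)%R /\ a%:E < F x].
  by apply/seteqP; split=> x; rewrite /xsection/= inE.
rewrite ge0_integral_layer_cake// => sF.
have sV : s%:E < (leb \x mu) V.
  by rewrite (lt_le_trans sF)//; under eq_integral do rewrite -xV.
have mV k : measurable (V `&` [set z | (z.1 <= k)%R]).
  apply: measurableI => //; rewrite -[X in measurable X]setTI.
  apply: (@measurable_fst _ _ T1 U measurableT [set x | (x <= k)%R]).
  rewrite (_ : [set x | _] = `]-oo, k]%classic); first exact: measurable_itv.
  by apply/seteqP; split=> x; rewrite /= in_itv.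
have [k sVk] := measure_lt_approx (fun k => mV k%:R)
  (nondecreasing_truncate V fst) (bigcup_truncate V fst) sV.
have sVk' : s%:E < \int[leb]_a
    mu (xsection (V `&` [set z | (z.1 <= k%:R)%R]) a) by exact: sVk.
pose E := [set a : R | (0 < a <= k%:R)%R /\ 0 < mu [set x | a%:E < F x]].
have mlev a := measurable_superlevel a%:E mF.
have sec a : mu (xsection (V `&` [set z | (z.1 <= k%:R)%R]) a) != 0 -> E a.
  have [ak|ak] := boolP (0 < a <= k%:R)%R; last first.
    rewrite (_ : xsection _ _ = set0) ?measure0 ?eqxx//.
    apply/seteqP; split=> // x; rewrite /xsection/= inE => -[[/= a0 _] ak'].
    by move: ak; rewrite a0 ak'.
  rewrite (_ : xsection _ _ = [set x | a%:E < F x]).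
    by rewrite -measure_gt0.
  have /andP[a0 ak'] := ak.
  apply/seteqP; split=> x; rewrite /xsection/= inE /V/undergraph/=; last by [].
  by case=> -[].
have neE : E !=set0.
  apply/set0P/eqP => E0; move: sVk'.
  rewrite integral0_eq ?ltNge ?lee_fin ?(ltW s0)// => a _ /=.
  by apply/eqP/negPn/negP => /sec; rewrite E0.
have hE : has_sup E by split => //; exists k%:R => a [/andP[]].
pose S := sup E.
have S0 : (0 < S)%R.
  have [a Ea] := neE; have [/andP[a0 _] _] := Ea.
  by rewrite (lt_le_trans a0)//; exact: sup_upper_bound.
have below a : (a < S)%R -> 0 < mu [set x | a%:E < F x].
  move=> aS; have [b [_ b0] ab] := sup_gt neE aS.
  rewrite (lt_le_trans b0)//; apply: le_measure; rewrite ?inE//.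
  by move=> x /=; apply: lt_trans; rewrite lte_fin.
pose f (a : T1) := (if (0 < a < S)%R then mu [set x | a%:E < F x] else 0).
have fE a : f a = (\1_(`]0%R, S[%classic : set T1) a)%:E *
     mu [set x | (0 < a)%R /\ a%:E < F x].
  rewrite /f indicE; case: ifPn => aS.
    rewrite mem_set ?in_itv// mul1e; congr (mu _).
    by have /andP[a0 _] := aS; apply/seteqP; split=> x /=; [|case].
  by rewrite memNset ?mul0e//= in_itv; apply/negP.
have mf : measurable_fun [set: T1] f.
  rewrite (_ : f = (fun a => (\1_(`]0%R, S[%classic : set T1) a)%:E *
     mu [set x | (0 < a)%R /\ a%:E < F x])); last exact/funext.
  apply: emeasurable_funM; last exact: measurable_fun_superlevel.
  by apply/measurable_EFinP; exact: measurable_indic.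
have f0 a : 0 <= f a by rewrite /f; case: ifP.
have levE a : mu (level F S a) = f (S * a + 0)%R.
  rewrite /f addr0 pmulr_rgt0// gtr_pMr//; case: ifPn => a01.
    by rewrite level01.
  by rewrite levelN01// measure0.
exists S; split => //.
- by move=> a a01; rewrite level01//; apply: below; rewrite gtr_pMr//; case/andP: a01.
- under eq_fun do rewrite levE.
  by apply: (measurableT_comp mf); exact: measurable_affine.
- under eq_integral do rewrite levE.
  have := ge0_integral_affine 0 (lt0r_neq0 S0) mf f0; rewrite gtr0_norm// => <-.
  rewrite (lt_le_trans sVk')// le_eqVlt; apply/orP; left.
  apply/eqP; apply: ge0_ae_eq_integral => //.
    exact: measurable_fun_xsection.
  (* Beyond S the levels are null, and the single height S has measure 0. *)
  exists [set S]; split => //; first exact: lebesgue_measure_set1.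
  move=> a /= /not_implyP[_ fa]; apply: contrapT => aS; apply: fa.
  rewrite /f; case: ifPn => aS'.
    have /andP[a0 aS''] := aS'.
    have [b [/andP[_ bk] _] ab] := sup_gt neE aS''.
    congr (mu _); apply/seteqP; split=> x; rewrite /xsection/= inE.
      by case=> -[].
    by move=> aF; split; [split|exact: le_trans (ltW ab) bk].
  apply/eqP/negPn/negP => /sec Ea; move: aS'; have [/andP[-> _] _] := Ea.
  by rewrite lt_neqAle (sup_upper_bound hE Ea) andbT => /negPn/eqP.
Qed.

End approx.

Section brunn_minkowski_prekopa_leindler.
Context {R : realType}.
Local Notation T1 := (measurableTypeR R).
Local Notation leb := (@lebesgue_measure R).
Local Open Scope ereal_scope.

Lemma brunn_minkowski_1d (A B C : set T1) (N : set (T1 * T1)) :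
  measurable A -> measurable B -> measurable C -> measurable N ->
  (leb \x leb) N = 0 ->
  (forall x y, A x -> B y -> ~ N (x, y) -> C (x - y)%R) ->
  0 < leb A -> 0 < leb B -> leb A + leb B <= leb C.
Proof.
move=> mA mB mC mN N0 ABC A0 B0.
pose tr (S : set T1) (k : nat) : set T1 := S `&` [set x | (x <= k%:R)%R].
have mtr S : measurable S -> forall k, measurable (tr S k).
  move=> mS k; apply: measurableI => //.
  rewrite (_ : [set x | _] = `]-oo, k%:R]%classic); first exact: measurable_itv.
  by apply/seteqP; split=> x; rewrite /= in_itv.
have ndtr S : nondecreasing_seq (tr S) by exact: (@nondecreasing_truncate R _ T1 S id).
have cvtr S : measurable S -> leb (tr S k) @[k --> \oo] --> leb S.
  move=> mS; have := @nondecreasing_cvg_mu _ _ _ leb (tr S) (mtr S mS).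
  have -> : \bigcup_k tr S k = S by rewrite -(@bigcup_truncate R _ T1 S id).
  by apply.
have [ka ka0] := measure_lt_approx (mtr _ mA) (ndtr A)
  (@bigcup_truncate R _ T1 A id) A0.
have [kb kb0] := measure_lt_approx (mtr _ mB) (ndtr B)
  (@bigcup_truncate R _ T1 B id) B0.
have mono S m k : measurable S -> (m <= k)%N -> leb (tr S m) <= leb (tr S k).
  move=> mS mk; apply: le_measure; rewrite ?inE; [exact: mtr|exact: mtr|].
  exact/subsetPset/ndtr.
have cAB : leb (tr A k) + leb (tr B k) @[k --> \oo] --> leb A + leb B.
  by apply: cvgeD; [rewrite ge0_adde_def ?inE|exact: cvtr|exact: cvtr].
apply: cvge_to_le cAB _.
exists (maxn ka kb) => // k /= kk.
apply: (@brunn_minkowski_bounded R _ _ C N k%:R) => //; [exact: mtr|exact: mtr| | | | |].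
- by move=> x y [Ax _] [By _]; exact: ABC.
- by move=> x [].
- by move=> x [].
- by rewrite (lt_le_trans ka0)// mono// (leq_trans _ kk)// leq_maxl.
- by rewrite (lt_le_trans kb0)// mono// (leq_trans _ kk)// leq_maxr.
Qed.

(** The inequality K a^(1-l) b^l <= c in [0, +oo], tested on the positive
    reals strictly below a and b. In this form it is meaningful for infinite
    a and b, it is void when a or b is 0, and it passes to integrals without
    any integrability hypothesis. *)
Definition geometric_le (l : R) (K : R) (a b c : \bar R) :=
  forall s t : R, (0 < s)%R -> (0 < t)%R -> s%:E < a -> t%:E < b ->
  (K * (s `^ (1 - l) * t `^ l))%:E <= c.

(** Differences of a point of the level a of F and a point of the level a of
    G lie in the level a of H, for top heights S, T and
    L = K S^(1-l) T^l. By the Brunn-Minkowski inequality the measures of the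
    levels add up; integrating over a, the integral of H is at least L times
    the sum of the integrals of F / S and G / T, and the
    arithmetic-geometric inequality removes S and T. *)
Lemma prekopa_leindler_1d (l K : R) (F G H : T1 -> \bar R) (N : set (T1 * T1)) :
  (0 < l < 1)%R -> (0 < K)%R ->
  measurable_fun [set: T1] F -> measurable_fun [set: T1] G ->
  measurable_fun [set: T1] H ->
  (forall x, 0 <= F x) -> (forall x, 0 <= G x) -> (forall x, 0 <= H x) ->
  measurable N -> (leb \x leb) N = 0 ->
  (forall x y, ~ N (x, y) -> geometric_le l K (F x) (G y) (H (x - y)%R)) ->
  geometric_le l (amgm_const l * K) (\int[leb]_x F x) (\int[leb]_x G x)
    (\int[leb]_x H x).
Proof.
move=> l01 K0 mF mG mH F0 G0 H0 mN N0 FGH s t s0 t0 sF tG.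
have /andP[l0 l1] := l01.
have [S [S0 posA mA sA]] := level_decomposition mF F0 s0 sF.
have [T [T0 posB mB tB]] := level_decomposition mG G0 t0 tG.
pose L := (K * (S `^ (1 - l) * T `^ l))%R.
have L0 : (0 < L)%R by rewrite !mulr_gt0// powR_gt0.
pose h (a : T1) := leb [set x | (0 < a)%R /\ a%:E < H x].
have mh : measurable_fun [set: T1] h by exact: measurable_fun_superlevel.
have key a : leb (level F S a) + leb (level G T a) <= h (L * a + 0)%R.
  have [a01|a01] := boolP (0 < a < 1)%R; last first.
    by rewrite !levelN01// !measure0 adde0.
  have /andP[a0 a1] := a01.
  apply: (@brunn_minkowski_1d _ _ _ N) => //;
    [exact: measurable_level|exact: measurable_level| | | |].
  - rewrite (_ : [set x | _] = [set x | (L * a + 0)%:E < H x]).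
      exact: measurable_superlevel.
    by apply/seteqP; split=> x /=; [case|rewrite addr0 mulr_gt0].
  - move=> x y [_ Fx] [_ Gy] Nxy; rewrite /= addr0; split; first exact: mulr_gt0.
    have gap (X : \bar R) (u : R) : (0 < u)%R -> u%:E < X ->
        exists v : R, (u < v)%R /\ v%:E < X.
      move=> u0; case: X => [r| |]//.
        rewrite lte_fin => ur; exists ((u + r) / 2)%R.
        by rewrite lte_fin; split; lra.
      by exists (u + 1)%R; rewrite ltry ltrDl.
    have [v [uv vF]] := gap _ _ (mulr_gt0 S0 a0) Fx.
    have [w [uw wG]] := gap _ _ (mulr_gt0 T0 a0) Gy.
    have v0 := lt_trans (mulr_gt0 S0 a0) uv.
    have w0 := lt_trans (mulr_gt0 T0 a0) uw.
    apply: lt_le_trans (FGH _ _ Nxy v w v0 w0 vF wG); rewrite lte_fin.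
    rewrite /L -mulrA ltr_pM2l//.
    have -> : (S `^ (1 - l) * T `^ l * a = (S * a) `^ (1 - l) * (T * a) `^ l)%R.
      have [S0' [T0' a0']] := (ltW S0, (ltW T0, ltW a0)).
      rewrite !powRM// mulrACA -powRD ?subrK ?powRr1//.
      by rewrite gt_eqF// implybT.
    apply: ltr_pM; rewrite ?powR_ge0//.
      by apply: gt0_ltr_powR; rewrite ?subr_gt0// nnegrE ltW// mulr_gt0.
    by apply: gt0_ltr_powR => //; rewrite nnegrE ltW// mulr_gt0.
  - exact: posA.
  - exact: posB.
rewrite (ge0_integral_layer_cake _ mH H0).
rewrite (ge0_integral_affine 0 (lt0r_neq0 L0) mh (fun=> measure_ge0 _ _)).
rewrite gtr0_norm//.
apply: (@le_trans _ _ (L%:E * (\int[leb]_a leb (level F S a) +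
    \int[leb]_a leb (level G T a)))); last first.
  rewrite -ge0_integralD// lee_pmul2l//; apply: ge0_le_integral => //.
  - by move=> a _; apply: adde_ge0.
  - exact: emeasurable_funD.
  - by apply: (measurableT_comp mh); exact: measurable_affine.
have half (u X : R) (Y : \bar R) : (0 < X)%R -> u%:E < X%:E * Y -> (u / X)%:E <= Y.
  by move=> X0 /ltW uY; rewrite mulrC EFinM lee_pdivrMl.
have sA' := half _ _ _ S0 sA; have tB' := half _ _ _ T0 tB.
apply: (@le_trans _ _ (L%:E * (s / S + t / T)%:E)); last first.
  by rewrite lee_pmul2l// EFinD leeD.
rewrite -EFinM lee_fin.
have -> : (amgm_const l * K * (s `^ (1 - l) * t `^ l) =
    L * (amgm_const l * ((s / S) `^ (1 - l) * (t / T) `^ l)))%R.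
  have E (u v w : R) : (0 < u)%R -> (0 < v)%R -> ((u / v) `^ w * v `^ w = u `^ w)%R.
    by move=> u0 v0; rewrite -powRM ?divfK ?gt_eqF// ltW// divr_gt0.
  by rewrite -(E s S)// -(E t T)// /L; ring.
by rewrite ler_pM2l// amgm_const_le// divr_gt0.
Qed.

End brunn_minkowski_prekopa_leindler.

(** * The Prekopa-Leindler inequality in R^n *)

Section prekopa_leindler.
Context {R : realType}.
Local Notation T1 := (measurableTypeR R).
Local Notation leb := (@lebesgue_measure R).
Local Open Scope ereal_scope.

Definition tuple_sub n (x y : 'R[R]_n) : 'R[R]_n :=
  [tuple ((tnth x i : R) - (tnth y i : R))%R | i < n].

Lemma tuple_sub_consR n (a b : T1) (x y : 'R[R]_n) :
  tuple_sub (consR (a, x)) (consR (b, y)) = consR ((a - b)%R, tuple_sub x y).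
Proof.
apply: eq_from_tnth => i; rewrite tnth_mktuple.
by case: (unliftP ord0 i) => [j ->|->] //; rewrite !tnthS tnth_mktuple.
Qed.

Lemma lebesgueRnSE n (A : set 'R[R]_n.+1) :
  lebesgueRn n.+1 A = \int[leb]_a lebesgueRn n [set x | A (consR (a, x))].
Proof.
rewrite -[LHS]/(\int[leb]_a lebesgueRn n (xsection (@consR R n @^-1` A) a)).
apply: eq_integral => a _; congr (lebesgueRn n _).
by apply/seteqP; split=> x; rewrite /xsection/= inE.
Qed.

(** The null set lives on pairs (a :: x, b :: y), where it is integrated in
    the order a, x, b, y; exchanging the two middle integrals shows that for
    almost all (a, b) its slice is null in the remaining variables. *)
Lemma null_cons_slices n (N : set ('R[R]_n.+1 * 'R[R]_n.+1)) :
  measurable N -> (lebesgueRn n.+1 \x lebesgueRn n.+1) N = 0 ->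
  exists Z : set (T1 * T1), [/\ measurable Z, (leb \x leb) Z = 0 &
    forall a b, ~ Z (a, b) ->
      let slice := [set z : 'R[R]_n * 'R[R]_n |
                     N (consR (a, z.1), consR (b, z.2))] in
      measurable slice /\ (lebesgueRn n \x lebesgueRn n) slice = 0].
Proof.
move=> mN N0.
pose c4 (z : ((T1 * T1) * 'R[R]_n) * 'R[R]_n) : 'R[R]_n.+1 * 'R[R]_n.+1 :=
  (consR (z.1.1.1, z.1.2), consR (z.1.1.2, z.2)).
have mc4 : measurable_fun setT c4.
  have m11 : measurable_fun setT
      (fun z : ((T1 * T1) * 'R[R]_n) * 'R[R]_n => z.1.1).
    exact: (measurableT_comp measurable_fst measurable_fst).
  apply/measurable_fun_pair; apply: (measurableT_comp (@measurable_consR R n)).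
    apply/measurable_fun_pair; first exact: (measurableT_comp measurable_fst m11).
    exact: (measurableT_comp measurable_snd measurable_fst).
  by apply/measurable_fun_pair; first exact: (measurableT_comp measurable_snd m11).
have mS : measurable (c4 @^-1` N).
  by rewrite -[X in measurable X]setTI; apply: mc4.
pose g z := lebesgueRn n [set y | (c4 @^-1` N) (z, y)].
have gE : g = lebesgueRn n \o xsection (c4 @^-1` N).
  apply/funext => z; congr (lebesgueRn n _).
  by apply/seteqP; split=> y; rewrite /xsection/= inE.
have mg : measurable_fun setT g by rewrite gE; exact: measurable_fun_xsection.
have g0 z : 0 <= g z by exact: measure_ge0.
pose k (ab : T1 * T1) := \int[lebesgueRn n]_x g (ab, x).
have mk : measurable_fun setT k.
  exact: (@measurable_fun_fubini_tonelli_F _ _ _ _ _ (lebesgueRn n) _ mg g0).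
have k0 ab : 0 <= k ab by apply: integral_ge0.
have Ik : \int[leb \x leb]_ab k ab = 0.
  rewrite (@fubini_tonelli1 _ _ _ _ _ leb leb _ mk k0) -N0.
  rewrite -[RHS]/(\int[lebesgueRn n.+1]_z lebesgueRn n.+1 (xsection N z)).
  rewrite ge0_integral_lebesgueRnS; last 2 first.
  - exact: measurable_fun_xsection.
  - by [].
  apply: eq_integral => a _; rewrite /fubini_F /k.
  under [RHS]eq_integral do rewrite lebesgueRnSE.
  rewrite (@fubini_tonelli _ _ _ _ _ leb (lebesgueRn n)
    (fun z : T1 * 'R[R]_n => g ((a, z.1), z.2)))//; last first.
    apply: (measurableT_comp mg); apply/measurable_fun_pair => //=.
    by apply/measurable_fun_pair => //=; exact: measurable_fst.
  apply: eq_integral => x _; apply: eq_integral => b _; congr (lebesgueRn n _).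
  by apply/seteqP; split=> y; rewrite /xsection/= inE.
exists [set ab | k ab != 0].
have mZ : measurable [set ab | k ab != 0].
  by rewrite -[X in measurable X]setTI; exact: (emeasurable_neq measurableT mk 0).
split => //.
  have : \int[leb \x leb]_ab `|k ab| = 0.
    by rewrite -[RHS]Ik; apply: eq_integral => x _; rewrite gee0_abs.
  move=> /(ae_eq_integral_abs (leb \x leb) measurableT mk).1.
  move=> [W [mW W0 ZW]]; apply: (subset_measure0 mZ mW _ W0).
  by move=> x /= /eqP Zx; apply: ZW => /= /(_ I).
move=> a b /= /negP/negPn/eqP kab; split.
  pose c2 (z : 'R[R]_n * 'R[R]_n) : 'R[R]_n.+1 * 'R[R]_n.+1 :=
    (consR (a, z.1), consR (b, z.2)).
  have mc2 : measurable_fun setT c2.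
    apply/measurable_fun_pair; apply: (measurableT_comp (@measurable_consR R n)).
      by apply/measurable_fun_pair => //; exact: measurable_fst.
    by apply/measurable_fun_pair => //; exact: measurable_snd.
  by rewrite -[X in measurable X]setTI; apply: mc2.
rewrite -[LHS]/(\int[lebesgueRn n]_x lebesgueRn n (xsection
  [set z : 'R[R]_n * 'R[R]_n | N (consR (a, z.1), consR (b, z.2))] x)).
rewrite -[RHS]kab; apply: eq_integral => x _; congr (lebesgueRn n _).
by apply/seteqP; split=> y; rewrite /xsection/= inE.
Qed.

(** Induction on n: for almost all first coordinates a and b the slices of
    F, G and H satisfy the hypothesis in dimension n, so that their integrals
    satisfy the hypothesis of the one-dimensional case. *)
Lemma prekopa_leindler n (l K : R) (F G H : 'R[R]_n -> \bar R)
    (N : set ('R[R]_n * 'R[R]_n)) :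
  (0 < l < 1)%R -> (0 < K)%R ->
  measurable_fun [set: 'R[R]_n] F -> measurable_fun [set: 'R[R]_n] G ->
  measurable_fun [set: 'R[R]_n] H ->
  (forall x, 0 <= F x) -> (forall x, 0 <= G x) -> (forall x, 0 <= H x) ->
  measurable N -> (lebesgueRn n \x lebesgueRn n) N = 0 ->
  (forall x y, ~ N (x, y) -> geometric_le l K (F x) (G y) (H (tuple_sub x y))) ->
  geometric_le l (amgm_const l ^+ n * K) (\int[lebesgueRn n]_x F x)
    (\int[lebesgueRn n]_x G x) (\int[lebesgueRn n]_x H x).
Proof.
move=> l01; elim: n K F G H N => [|n IH] K F G H N K0 mF mG mH F0 G0 H0 mN N0 FGH.
  rewrite !integral_dirac// !diracT !mul1e expr0 mul1r.
  have -> : H [tuple] = H (tuple_sub [tuple] [tuple]).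
    by congr H; apply: eq_from_tnth => -[].
  apply: FGH => Npt; move: N0.
  (* A set of the one-point space of pairs that is not empty has measure 1. *)
  have -> : N = [set: 'R[R]_0] `*` [set: 'R[R]_0].
    apply/seteqP; split => // -[x y] _; move: Npt.
    by congr N; congr pair; apply: eq_from_tnth => -[].
  by rewrite product_measure1E//= !diracT mule1 => /eqP; rewrite onee_eq0.
have c0 : (0 < amgm_const l)%R.
  by rewrite invr_gt0 mulr_gt0// powR_gt0//; case/andP: l01 => ? ?; rewrite ?subr_gt0.
have mcons (X : 'R[R]_n.+1 -> \bar R) : measurable_fun [set: 'R[R]_n.+1] X ->
    measurable_fun [set: T1 * 'R[R]_n] (X \o @consR R n).
  by move=> mX; apply: (measurableT_comp mX); exact: measurable_consR.
have msec (X : 'R[R]_n.+1 -> \bar R) a : measurable_fun [set: 'R[R]_n.+1] X ->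
    measurable_fun [set: 'R[R]_n] (fun x => X (consR (a, x))).
  move=> /mcons mX.
  have mp : measurable_fun setT (fun x : 'R[R]_n => (a, x)) by apply/measurable_fun_pair.
  exact: (measurableT_comp mX mp).
have mint (X : 'R[R]_n.+1 -> \bar R) :
    measurable_fun [set: 'R[R]_n.+1] X -> (forall x, 0 <= X x) ->
    measurable_fun [set: T1] (fun a : T1 => \int[lebesgueRn n]_x X (consR (a, x))).
  move=> mX X0.
  exact: (@measurable_fun_fubini_tonelli_F _ _ _ _ _ (lebesgueRn n) _
    (mcons _ mX) (fun z => X0 _)).
have [Z [mZ Z0 ZN]] := null_cons_slices mN N0.
rewrite !ge0_integral_lebesgueRnS// exprS -mulrA.
apply: prekopa_leindler_1d mZ Z0 _ => //.
- by rewrite mulr_gt0// exprn_gt0.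
- exact: mint.
- exact: mint.
- exact: mint.
- by move=> a; apply: integral_ge0.
- by move=> a; apply: integral_ge0.
- by move=> a; apply: integral_ge0.
move=> a b /ZN[mab Nab].
apply: IH Nab _ => //; [exact: msec|exact: msec|exact: msec|].
by move=> x y Nxy; rewrite -tuple_sub_consR; exact: FGH.
Qed.
End prekopa_leindler.

(** * Balls and the Brunn-Minkowski inequality in R^n *)

Section geometry.
Context {R : realType}.
Local Notation T1 := (measurableTypeR R).
Local Notation leb := (@lebesgue_measure R).

Definition tuple_scale n (c : R) (x : 'R[R]_n) : 'R[R]_n :=
  [tuple c * (tnth x i : R) | i < n].

Lemma measurable_coord n (i : 'I_n) :
  measurable_fun [set: 'R[R]_n] (fun x : 'R[R]_n => tnth x i : R).
Proof. exact: (@measurable_tnth _ T1). Qed.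

Lemma measurable_tuple_scale n (c : R) : measurable_fun [set: 'R[R]_n] (tuple_scale c).
Proof.
apply/measurable_fun_tnthP => i.
rewrite (_ : _ \o _ = (fun x : 'R[R]_n => c * (tnth x i : R))); last first.
  by apply/funext => x /=; rewrite tnth_mktuple.
by apply: measurable_funM => //; exact: measurable_coord.
Qed.

Lemma tuple_scale_consR n (c : R) (a : T1) (x : 'R[R]_n) :
  tuple_scale c (consR (a, x)) = consR (c * a : T1, tuple_scale c x).
Proof.
apply: eq_from_tnth => i; rewrite tnth_mktuple.
by case: (unliftP ord0 i) => [j ->|->] //; rewrite !tnthS tnth_mktuple.
Qed.

Lemma measurable_enorm n : measurable_fun [set: 'R[R]_n] (@enorm R n).
Proof.
rewrite (_ : @enorm R n = fun x => (\sum_(i < n) (tnth x i : R) ^+ 2) `^ (2^-1)).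
  apply: measurableT_comp (measurable_powR _) _.
  by apply: measurable_sum => i; apply: measurable_funX; exact: measurable_coord.
by apply/funext => x; rewrite powR12_sqrt// sumr_ge0// => i _; exact: sqr_ge0.
Qed.

Lemma enorm_ge0 n (x : 'R[R]_n) : 0 <= enorm x.
Proof. exact: sqrtr_ge0. Qed.

Lemma sqr_enorm n (x : 'R[R]_n) : enorm x ^+ 2 = \sum_(i < n) (tnth x i : R) ^+ 2.
Proof. by rewrite sqr_sqrtr// sumr_ge0// => i _; exact: sqr_ge0. Qed.

Lemma enorm_scale n (c : R) (x : 'R[R]_n) : 0 <= c ->
  enorm (tuple_scale c x) = c * enorm x.
Proof.
move=> c0; rewrite /enorm (_ : \sum_(i < n) _ =
  c ^+ 2 * \sum_(i < n) (tnth x i : R) ^+ 2).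
  by rewrite sqrtrM ?sqr_ge0// sqrtr_sqr ger0_norm.
by rewrite mulr_sumr; apply: eq_bigr => i _; rewrite tnth_mktuple exprMn.
Qed.

Lemma edistE n (x y : 'R[R]_n) : Defs.edist x y = enorm (tuple_sub x y).
Proof.
by rewrite /Defs.edist /enorm; congr Num.sqrt; apply: eq_bigr => i _; rewrite tnth_mktuple.
Qed.

Local Open Scope ereal_scope.

Lemma lebesgueRn_scale n (c : R) (A : set 'R[R]_n) : (0 < c)%R -> measurable A ->
  lebesgueRn n A = (c ^+ n)%:E * lebesgueRn n [set x | A (tuple_scale c x)].
Proof.
move=> c0; elim: n A => [|n IH] A mA.
  rewrite expr0 mul1e; congr (lebesgueRn 0 _); apply/seteqP.
  by split=> x; rewrite /= (_ : tuple_scale c x = x)//; apply: eq_from_tnth => -[].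
rewrite !lebesgueRnSE.
have mAx a : measurable [set x : 'R[R]_n | A (consR (a, x))].
  rewrite -[X in measurable X]setTI.
  have mp : measurable_fun setT (fun x : 'R[R]_n => consR (a, x)).
    by apply: (measurableT_comp (@measurable_consR R n)); apply/measurable_fun_pair.
  exact: mp.
under eq_integral do rewrite IH//.
pose f (a : T1) := lebesgueRn n [set x | A (consR (a, tuple_scale c x))].
pose c2 (z : T1 * 'R[R]_n) := consR (z.1, tuple_scale c z.2).
have mc2 : measurable_fun setT c2.
  apply: (measurableT_comp (@measurable_consR R n)); apply/measurable_fun_pair => //.
  exact: (measurableT_comp (measurable_tuple_scale c) measurable_snd).
have mA2 : measurable (c2 @^-1` A) by rewrite -[X in measurable X]setTI; apply: mc2.
have mf : measurable_fun [set: T1] f.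
  have := measurable_fun_xsection (lebesgueRn n) mA2.
  congr (measurable_fun _ _); apply/funext => a /=; congr (lebesgueRn n _).
  by apply/seteqP; split=> x; rewrite /xsection/= inE.
have cn0 : (0 <= c ^+ n)%R by rewrite exprn_ge0// ltW.
rewrite ge0_integralZl_EFin//.
rewrite (ge0_integral_affine 0 (lt0r_neq0 c0) mf (fun=> measure_ge0 _ _)).
rewrite gtr0_norm// muleA -EFinM -exprSr; congr (_ * _).
apply: eq_integral => a _; rewrite /f addr0; congr (lebesgueRn n _).
by apply/seteqP; split=> x /=; rewrite tuple_scale_consR.
Qed.

Definition eball n (r : R) : set 'R[R]_n := [set x | (enorm x <= r)%R].

Lemma measurable_eball n (r : R) : measurable (@eball n r).
Proof.
rewrite -[X in measurable X]setTI (_ : eball r = @enorm R n @^-1` `]-oo, r]%classic).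
  by apply: measurable_enorm => //; exact: measurable_itv.
by apply/seteqP; split=> x; rewrite /= in_itv.
Qed.

Definition ball_volume n : R := fine (lebesgueRn n (@eball n 1)).

Lemma lebesgueRn_eball_scale n (r : R) : (0 < r)%R ->
  lebesgueRn n (eball r) = (r ^+ n)%:E * lebesgueRn n (@eball n 1).
Proof.
move=> r0; rewrite (lebesgueRn_scale r0 (measurable_eball r)); congr (_ * _).
congr (lebesgueRn n _); apply/seteqP; split=> x; rewrite /eball/=.
  by rewrite enorm_scale ?(ltW r0)// ger_pMr.
by rewrite enorm_scale ?(ltW r0)// ger_pMr.
Qed.

Lemma lebesgueRn_cube n :
  lebesgueRn n [set x : 'R[R]_n | forall i, (-1 <= (tnth x i : R) <= 1)%R] =
  (2 ^+ n)%:E.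
Proof.
have := @lebesgueRn_box R n (fun=> `[(-1)%R, 1%R]%classic) (fun=> measurable_itv _).
have -> : [set t : 'R[R]_n | forall i : 'I_n, `[(-1)%R, 1%R]%classic (tnth t i)] =
    [set x | forall i, (-1 <= (tnth x i : R) <= 1)%R].
  by apply/seteqP; split=> x /= xi i; have := xi i; rewrite /= in_itv.
move=> ->; rewrite (eq_bigr (fun=> 2%:E)); last first.
  move=> i _; rewrite lebesgue_measure_itv/= lte_fin ifT; last by lra.
  by rewrite -EFinB opprK.
by rewrite prodEFin prodr_const card_ord.
Qed.

Lemma measurable_cube n :
  measurable [set x : 'R[R]_n | forall i, (-1 <= (tnth x i : R) <= 1)%R].
Proof.
rewrite (_ : [set x | _] = \bigcap_(i in [set: 'I_n])
    ((fun x : 'R[R]_n => tnth x i : R) @^-1` `[(-1)%R, 1%R]%classic)).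
  apply: fin_bigcap_measurable => // i _; rewrite -[X in measurable X]setTI.
  by apply: (@measurable_coord n i measurableT); exact: measurable_itv.
by apply/seteqP; split=> t /= At i => [_|]; have := At i; rewrite /= in_itv/= //; apply.
Qed.

(** The unit ball lies in the cube [-1, 1]^n, which lies in the ball of
    radius n + 1. *)
Lemma ball_volume_fin n : lebesgueRn n (@eball n 1) = (ball_volume n)%:E /\
  (0 < ball_volume n)%R.
Proof.
have fin : lebesgueRn n (@eball n 1) \is a fin_num.
  rewrite ge0_fin_numE//; apply: (@le_lt_trans _ _ (2 ^+ n)%:E); last exact: ltry.
  rewrite -lebesgueRn_cube; apply: le_measure; rewrite ?inE.
  - exact: measurable_eball.
  - exact: measurable_cube.
  move=> x; rewrite /eball/= => x1 i.
  rewrite -ler_norml -(@ler_pXn2r _ 2%N)// ?nnegrE//.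
  rewrite expr1n real_normK ?num_real//.
  have : (enorm x ^+ 2 <= 1 ^+ 2)%R by rewrite ler_pXn2r ?nnegrE ?enorm_ge0.
  rewrite expr1n sqr_enorm; apply: le_trans.
  by rewrite (bigD1 i)//= lerDl sumr_ge0// => j _; exact: sqr_ge0.
split; first by rewrite fineK.
have n0 : (0 < n.+1%:R :> R)%R by [].
have : (2 ^+ n)%:E <= lebesgueRn n (@eball n n.+1%:R).
  rewrite -lebesgueRn_cube; apply: le_measure; rewrite ?inE.
  - exact: measurable_cube.
  - exact: measurable_eball.
  move=> x /= xi; rewrite /eball/= -(@ler_pXn2r _ 2%N) ?nnegrE ?enorm_ge0//.
  rewrite sqr_enorm; apply: (@le_trans _ _ n%:R).
    rewrite -[X in (_ <= X%:R)%R]card_ord -sum1_card natr_sum.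
    by apply: ler_sum => i _; have := xi i; nra.
  by rewrite -natrX ler_nat (leq_trans (leqnSn n))// -{1}[n.+1]expn1 leq_pexp2l.
rewrite lebesgueRn_eball_scale// -(fineK fin) -/(ball_volume n) -EFinM lee_fin.
move=> h; have : (0 < 2 ^+ n :> R)%R by rewrite exprn_gt0.
by move=> /lt_le_trans/(_ h); rewrite pmulr_rgt0// exprn_gt0.
Qed.

Lemma ball_volume_gt0 n : (0 < ball_volume n)%R.
Proof. exact: (ball_volume_fin n).2. Qed.

Lemma lebesgueRn_eball n (r : R) : (0 < r)%R ->
  lebesgueRn n (eball r) = (ball_volume n * r ^+ n)%:E.
Proof.
by move=> r0; rewrite lebesgueRn_eball_scale// (ball_volume_fin n).1 -EFinM mulrC.
Qed.

(** This is the Brunn-Minkowski inequality for A - B, which up to a null set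
    of pairs is contained in a ball of radius d: the Prekopa-Leindler
    inequality is applied to indicator functions with the weight l = q / (r + q), for which
    amgm_const l * r^(1-l) * q^l is exactly r + q. *)
Lemma radius_sum_le n (A B : set 'R[R]_n) (N : set ('R[R]_n * 'R[R]_n)) (r q d : R) :
  (0 < n)%N -> (0 < r)%R -> (0 < q)%R -> (0 < d)%R ->
  measurable A -> measurable B ->
  measurable N -> (lebesgueRn n \x lebesgueRn n) N = 0 ->
  (forall x y, A x -> B y -> ~ N (x, y) -> (Defs.edist x y <= d)%R) ->
  (ball_volume n * r ^+ n)%:E < lebesgueRn n A ->
  (ball_volume n * q ^+ n)%:E < lebesgueRn n B ->
  (r + q <= d)%R.
Proof.
move=> n0 r0 q0 d0 mA mB mN N0 ABd rA qB.
have rq0 : (0 < r + q)%R by rewrite addr_gt0.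
pose l := (q / (r + q))%R.
have l1E : (1 - l = r / (r + q))%R by rewrite /l; field; rewrite gt_eqF.
have l0 : (0 < l)%R by rewrite divr_gt0.
have l1 : (0 < 1 - l)%R by rewrite l1E divr_gt0.
have l01 : (0 < l < 1)%R by rewrite l0 -subr_gt0.
have v0 := ball_volume_gt0 n.
have mI (S : set 'R[R]_n) : measurable S ->
    measurable_fun setT (fun x => (\1_S x)%:E : \bar R).
  by move=> mS; apply/measurable_EFinP; exact: measurable_indic.
have int (S : set 'R[R]_n) : measurable S ->
    \int[lebesgueRn n]_x (\1_S x)%:E = lebesgueRn n S.
  by move=> mS; rewrite integral_indic// setIT.
have mE := measurable_eball d : measurable (@eball n d).
have PL : geometric_le l (amgm_const l ^+ n * 1) (lebesgueRn n A)
    (lebesgueRn n B) (lebesgueRn n (eball d)).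
  rewrite -!int//; apply: (prekopa_leindler l01 ltr01 (mI _ mA) (mI _ mB)
    (mI _ mE) _ _ _ mN N0) => [x|x|x|x y Nxy]; rewrite ?lee_fin//.
  move=> s t s0 t0; rewrite !lte_fin !indicE.
  case: (boolP (x \in A)) => [/set_mem Ax|_ st]; last first.
    by have := lt_trans s0 st; rewrite ltxx.
  case: (boolP (y \in B)) => [/set_mem By|_ _ st]; last first.
    by have := lt_trans t0 st; rewrite ltxx.
  move=> s1 t1; rewrite mem_set; last by rewrite /eball/= -edistE; exact: ABd.
  have pow1 (u w : R) : (0 < u)%R -> (u < 1)%R -> (0 < w)%R -> (u `^ w <= 1)%R.
    move=> u0 u1 w0; have := @ge0_ler_powR R w (ltW w0) u 1%R.
    by rewrite powR1 => -> //; rewrite ?nnegrE ?ler01 ?ltW.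
  by rewrite lee_fin mul1r mulr_ile1 ?powR_ge0// pow1.
have := PL _ _ (mulr_gt0 v0 (exprn_gt0 n r0)) (mulr_gt0 v0 (exprn_gt0 n q0)) rA qB.
rewrite lebesgueRn_eball// lee_fin mulr1.
have powX (x w : R) : (0 < x)%R -> ((x ^+ n) `^ w = (x `^ w) ^+ n)%R.
  move=> x0; rewrite -[(x ^+ n)%R]powR_mulrn ?(ltW x0)//.
  by rewrite -[RHS]powR_mulrn ?powR_ge0// -!powRrM mulrC.
have -> : (amgm_const l ^+ n * ((ball_volume n * r ^+ n) `^ (1 - l) *
    (ball_volume n * q ^+ n) `^ l) = ball_volume n * (r + q) ^+ n)%R.
  rewrite !powRM ?exprn_ge0 ?ltW// mulrACA -powRD; last by rewrite (gt_eqF v0) implybT.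
  rewrite subrK powRr1 ?ltW// [LHS]mulrCA !powX//.
  rewrite -!exprMn; congr (_ * _ ^+ n)%R.
  have -> : amgm_const l = ((r + q) / (r `^ (1 - l) * q `^ l))%R.
    have E u w : (0 < u)%R -> ((u / (r + q)) `^ w = u `^ w * (r + q) `^ (- w))%R.
      move=> u0; rewrite powRM ?invr_ge0 ?ltW//; congr (_ * _)%R.
      by rewrite -powR_inv1 ?ltW// -powRrM mulN1r.
    rewrite /amgm_const {1}l1E {3}/l !E// mulrACA -powRD; last by rewrite (gt_eqF rq0) implybT.
    rewrite -opprD subrK powR_inv1 ?ltW// invfM invrK mulrC //.
  rewrite divfK// gt_eqF// mulr_gt0// powR_gt0//.
by rewrite ler_pM2l// ler_pXn2r// ?nnegrE ?ltW.
Qed.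

End geometry.

(** * Decreasing radial rearrangement in logarithmic polar coordinates *)

Section radial.
Context {R : realType}.
Local Notation T1 := (measurableTypeR R).
Local Notation leb := (@lebesgue_measure R).
Local Open Scope ereal_scope.

Section fixed_dimension.
Context (n : nat) (n_gt0 : (0 < n)%N).
Local Notation v := (@ball_volume R n).

(** The volume of the ball of radius e^u. *)
Definition expball_volume (u : R) : R := (v * expR (n%:R * u))%R.
(** The derivative in u of the volume of the ball of radius e^u. *)
Definition expball_density (u : R) : R := (n%:R * expball_volume u)%R.

Lemma expball_density_gt0 u : (0 < expball_density u)%R.
Proof. by rewrite !mulr_gt0 ?ltr0n ?ball_volume_gt0 ?expR_gt0. Qed.

Lemma expball_volumeE u : expball_volume u = (v * expR u ^+ n)%R.
Proof. by rewrite /expball_volume expRM_natl. Qed.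

Lemma continuous_expball_volume : continuous expball_volume.
Proof.
move=> x; apply: cvgM; first exact: cvg_cst.
apply: (@continuous_comp _ _ _ (fun u : R => n%:R * u)%R expR).
  by apply: cvgM; [exact: cvg_cst|exact: cvg_id].
exact: continuous_expR.
Qed.

Lemma measurable_expball_volume : measurable_fun [set: T1] (expball_volume : T1 -> R).
Proof. exact: continuous_measurable_fun continuous_expball_volume. Qed.

Lemma measurable_expball_density : measurable_fun [set: T1] (expball_density : T1 -> R).
Proof. by apply: measurable_funM => //; exact: measurable_expball_volume. Qed.

Lemma expball_volume_gt0 u : (0 < expball_volume u)%R.
Proof. by rewrite mulr_gt0 ?ball_volume_gt0 ?expR_gt0. Qed.

Lemma expball_volumeD u w :
  expball_volume (u + w) = (expball_volume u * expR (n%:R * w))%R.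
Proof. by rewrite /expball_volume mulrDr expRD mulrA. Qed.

Lemma ltr_expball_volume u w : (expball_volume u < expball_volume w)%R = (u < w)%R.
Proof. by rewrite ltr_pM2l ?ball_volume_gt0// ltr_expR ltr_pM2l// ltr0n. Qed.

Lemma expball_volume_surj (r : R) : (0 < r)%R -> exists L, expball_volume L = r.
Proof.
move=> r0; exists (ln (r / v) / n%:R)%R; rewrite /expball_volume.
have v0 := ball_volume_gt0 n : (0 < v)%R.
rewrite [X in expR X]mulrC divfK ?pnatr_eq0 -?lt0n// lnK ?posrE ?divr_gt0//.
by rewrite mulrC divfK// gt_eqF.
Qed.

Local Notation below m := [set u : T1 | (expball_volume u)%:E < m].

Lemma measurable_below (m : \bar R) : measurable (below m).
Proof.
rewrite -[X in measurable X]setTI; apply: measurable_lte => //.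
by apply/measurable_EFinP; exact: measurable_expball_volume.
Qed.

Lemma measurable_density_below (m : \bar R) : measurable_fun [set: T1]
  (fun u : T1 => (expball_density u)%:E * (\1_(below m) u)%:E).
Proof.
apply: emeasurable_funM; apply/measurable_EFinP.
  exact: measurable_expball_density.
by apply: measurable_indic; exact: measurable_below.
Qed.

Lemma density_below_ge0 (m : \bar R) (u : T1) :
  0 <= (expball_density u)%:E * (\1_(below m) u)%:E.
Proof. by rewrite mule_ge0// lee_fin ltW// expball_density_gt0. Qed.

(** The volume of a ball as the integral of the density over the smaller
    radii. With u = L - w the density is, up to the factor
    expball_volume L, that of the exponential law of rate n. *)
Lemma integral_expball_density_EFin (r : R) : (0 < r)%R ->
  \int[leb]_u ((expball_density u)%:E * (\1_(below r%:E) u)%:E) = r%:E.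
Proof.
move=> r0; have [L <-] := expball_volume_surj r0.
have N1 : (-1 : R)%R != 0%R by rewrite oppr_eq0 oner_eq0.
rewrite (ge0_integral_affine L N1 (measurable_density_below _)); last first.
  by move=> u; exact: density_below_ge0.
rewrite normrN1 mul1e.
have nR : (0 < n%:R :> R)%R by rewrite ltr0n.
have mE : measurable_fun [set: T1] (fun w : T1 => (exponential_pdf (n%:R : R) w)%:E).
  by apply/measurable_EFinP; exact: measurable_exponential_pdf.
have v0 := expball_volume_gt0 L.
rewrite -[RHS]mule1 -(integral_exponential_pdf nR) -ge0_integralZl_EFin//; last 2 first.
- by move=> w _; rewrite lee_fin exponential_pdf_ge0// ltW.
- exact: ltW.
apply: ge0_ae_eq_integral => //.
- apply: (measurableT_comp (measurable_density_below _)).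
  exact: (measurable_affine (-1) L).
- exact: measurable_funeM.
- by move=> u _; exact: density_below_ge0.
- by move=> u _; rewrite mule_ge0// lee_fin ?exponential_pdf_ge0// ltW.
exists [set 0%R]; split => //; first exact: lebesgue_measure_set1.
move=> w /= /not_implyP[_ fa]; apply: contrapT => w0; apply: fa.
rewrite indicE; have [wp|wn] := ltP 0%R w.
  rewrite mem_set ?mule1; last first.
    by rewrite /= lte_fin ltr_expball_volume mulN1r gtrDr oppr_lt0.
  rewrite exponential_pdfE ?ltW// -EFinM /expball_density addrC expball_volumeD.
  by congr EFin; rewrite mulN1r mulrN mulNr; ring.
have wlt : (w < 0)%R by rewrite lt_neqAle wn andbT; apply/eqP.
rewrite lt0_exponential_pdf// mule0 memNset ?mule0//=.
rewrite lte_fin ltr_expball_volume mulN1r gtrDr oppr_lt0.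
by apply/negP; rewrite -leNgt.
Qed.

Lemma integral_expball_density (m : \bar R) : 0 <= m ->
  \int[leb]_u ((expball_density u)%:E * (\1_(below m) u)%:E) = m.
Proof.
case: m => [r| |]//.
- rewrite lee_fin le_eqVlt => /predU1P[<-|]; last exact: integral_expball_density_EFin.
  apply: integral0_eq => u _; rewrite indicE memNset ?mule0//=.
  by rewrite lte_fin; apply/negP; rewrite -leNgt ltW// expball_volume_gt0.
- move=> _; apply/eqyP => r r0; rewrite -[leLHS]integral_expball_density_EFin//.
  apply: ge0_le_integral => //.
  + by move=> u _; exact: density_below_ge0.
  + exact: measurable_density_below.
  + exact: measurable_density_below.
  + move=> u _; rewrite lee_pmul2l ?lte_fin ?expball_density_gt0//.
    rewrite lee_fin !indicE (mem_set (_ : below +oo u)) ?lern1 ?leq_b1//.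
    by rewrite /= ltry.
Qed.

Definition height (F : 'R[R]_n -> \bar R) (s : R) : \bar R :=
  lebesgueRn n [set x | (0 < s)%R /\ s%:E < F x].

(** The value at radius e^u of the decreasing radial rearrangement of F: the
    length of the set of heights whose superlevel set has more volume than
    the ball of radius e^u. *)
Definition radial (F : 'R[R]_n -> \bar R) (u : R) : \bar R :=
  leb [set s : T1 | (expball_volume u)%:E < height F s].

Definition height_region (F : 'R[R]_n -> \bar R) : set (T1 * T1) :=
  [set z | (expball_volume z.1)%:E < height F z.2].

Lemma measurable_height_region F : measurable_fun [set: 'R[R]_n] F ->
  measurable (height_region F).
Proof.
move=> mF; rewrite -[X in measurable X]setTI; apply: measurable_lte => //.
  by apply/measurable_EFinP; apply: (measurableT_comp measurable_expball_volume).
exact: (measurableT_comp (measurable_fun_superlevel _ mF) measurable_snd).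
Qed.

Lemma xsection_height_region F u : xsection (height_region F) u =
  [set s : T1 | (expball_volume u)%:E < height F s].
Proof. by apply/seteqP; split=> s; rewrite /xsection/= inE. Qed.

Lemma measurable_radial F : measurable_fun [set: 'R[R]_n] F ->
  measurable_fun [set: T1] (radial F : T1 -> \bar R).
Proof.
move=> mF; have := measurable_fun_xsection leb (measurable_height_region mF).
by congr (measurable_fun _ _); apply/funext => u /=; rewrite xsection_height_region.
Qed.

(** Both sides integrate the density over the pairs (u, s) such that
    {F > s} has more volume than the ball of radius e^u. *)
Lemma radial_layer_cake F : measurable_fun [set: 'R[R]_n] F -> (forall x, 0 <= F x) ->
  \int[lebesgueRn n]_x F x = \int[leb]_u ((expball_density u)%:E * radial F u).
Proof.
move=> mF F0; rewrite ge0_integral_layer_cake//.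
have mR := measurable_height_region mF.
transitivity (\int[leb]_s \int[leb]_u
    ((expball_density u)%:E * (\1_(height_region F) (u, s))%:E)).
  apply: eq_integral => s _.
  rewrite -[LHS](@integral_expball_density (height F s))//.
rewrite -(@fubini_tonelli _ _ _ _ _ leb leb (fun z =>
    (expball_density z.1)%:E * (\1_(height_region F) z)%:E))//; last 2 first.
- apply: emeasurable_funM; apply/measurable_EFinP.
    exact: (measurableT_comp measurable_expball_density measurable_fst).
  exact: measurable_indic.
- by move=> z; rewrite mule_ge0// lee_fin ltW// expball_density_gt0.
apply: eq_integral => u _.
transitivity ((expball_density u)%:E *
    \int[leb]_s (\1_(height_region F) (u, s))%:E).
  rewrite -(@ge0_integralZl_EFin _ T1 R leb _ measurableT
    (fun s => (\1_(height_region F) (u, s))%:E))//.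
    apply/measurable_EFinP.
    have mp : measurable_fun setT (fun s : T1 => (u, s)) by apply/measurable_fun_pair.
    have mi : measurable_fun setT (\1_(height_region F) : T1 * T1 -> R) by exact: measurable_indic.
    exact: (measurableT_comp mi mp).
  by rewrite ltW// expball_density_gt0.
congr (_ * _).
have := @integral_indic _ T1 R leb setT measurableT _ (measurable_xsection u mR).
rewrite setIT {2}xsection_height_region => E; rewrite /radial -E.
apply: eq_integral => s _; rewrite !indicE; congr (_%:R)%:E.
by rewrite mem_xsection.
Qed.

Lemma lt_radial_exists F (u r : R) :
  measurable_fun [set: 'R[R]_n] F -> (0 < r)%R -> r%:E < radial F u ->
  exists s, (r <= s)%R /\ (expball_volume u)%:E < lebesgueRn n [set x | s%:E < F x].
Proof.
move=> mF r0 rF; apply: contrapT => /forallNP nex.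
move: rF; rewrite ltNge => /negP; apply.
have sub : [set s : T1 | (expball_volume u)%:E < height F s] `<=` `]0%R, r[%classic.
  move=> s; rewrite /height/= in_itv/= => us.
  have s0 : (0 < s)%R.
    rewrite ltNge; apply/negP => s0.
    have E0 : [set x | (0 < s)%R /\ s%:E < F x] = set0.
      by apply/seteqP; split=> // x [s1 _]; move: (lt_le_trans s1 s0); rewrite ltxx.
    move: us; rewrite E0 measure0 lte_fin => /lt_trans/(_ (expball_volume_gt0 u)).
    by rewrite ltxx.
  rewrite s0/= ltNge; apply/negP => rs; apply: (nex s); split => //.
  rewrite (_ : [set x | _] = [set x | (0 < s)%R /\ s%:E < F x])//.
  by apply/seteqP; split=> x //= [].
apply: (@le_trans _ _ (leb (`]0%R, r[%classic : set T1))); last first.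
  by rewrite lebesgue_measure_itv/= lte_fin r0 oppr0 adde0.
apply: le_measure => //; rewrite ?inE.
  by rewrite -xsection_height_region; exact: measurable_xsection (measurable_height_region mF).
exact: measurable_itv.
Qed.

End fixed_dimension.
End radial.

(** * The extremal density *)

Lemma mule_le_approx (R : realType) (x y : \bar R) (c : R) : (0 <= x)%E -> (0 <= y)%E ->
  (forall s t : R, 0 < s -> 0 < t -> (s%:E < x)%E -> (t%:E < y)%E -> s * t <= c) ->
  0 <= c -> (x * y <= c%:E)%E.
Proof.
move=> x0 y0 st c0.
have gap (a : \bar R) (b : R) : (b%:E < a)%E -> exists2 s : R, b < s & (s%:E < a)%E.
  case: a => [r| |]//.
    by rewrite lte_fin => br; exists ((b + r) / 2); rewrite ?lte_fin; lra.
  by exists (b + 1); rewrite ?ltry// ltrDl.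
have [->|xN] := eqVneq x 0%E; first by rewrite mul0e lee_fin.
have [->|yN] := eqVneq y 0%E; first by rewrite mule0 lee_fin.
have xp : (0 < x)%E by rewrite lt0e xN.
have yp : (0 < y)%E by rewrite lt0e yN.
have step (s : R) : 0 < s -> (s%:E < x)%E -> (s%:E * y <= c%:E)%E.
  move=> s0 sx; rewrite -lee_pdivlMl// -EFinM leNgt; apply/negP => /gap[t ct ty].
  have t0 : 0 < t by rewrite (le_lt_trans _ ct)// mulr_ge0// invr_ge0 ltW.
  have := st s t s0 t0 sx ty; rewrite leNgt => /negP; apply.
  by rewrite mulrC -ltr_pdivrMr// mulrC.
have [s0 s0p s0x] := gap _ _ xp.
have yf : y \is a fin_num.
  rewrite ge0_fin_numE// ltNge leye_eq; apply/negP => /eqP yE.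
  by have := step _ s0p s0x; rewrite yE gt0_muley ?lte_fin.
have y0f : 0 < fine y by rewrite fine_gt0// yp ltey_eq yf.
rewrite -(fineK yf) muleC -lee_pdivlMl// -EFinM leNgt; apply/negP => /gap[t ct tx].
have t0 : 0 < t by rewrite (le_lt_trans _ ct)// mulr_ge0// invr_ge0 ltW.
have := step _ t0 tx; rewrite -(fineK yf) -EFinM lee_fin leNgt => /negP; apply.
by rewrite mulrC -ltr_pdivrMl.
Qed.

Section endpoint.
Context {R : realType}.
Local Notation T1 := (measurableTypeR R).
Local Notation leb := (@lebesgue_measure R).
Local Open Scope ereal_scope.
Context (n : nat) (n_gt0 : (0 < n)%N).
Local Notation v := (@ball_volume R n).

(** The p-th power of the extremal function for every p; up to a power of 2
    it is the Jacobian of the stereographic projection. *)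
Definition bubble (x : 'R[R]_n) : R := ((1 + enorm x ^+ 2) ^+ n)^-1%R.

Lemma bubble_gt0 x : (0 < bubble x)%R.
Proof. by rewrite invr_gt0 exprn_gt0// ltr_wpDr// sqr_ge0. Qed.

Lemma measurable_inv_pow d (U : measurableType d) (f : U -> R) :
  (forall x, 0 < f x)%R -> measurable_fun [set: U] f ->
  measurable_fun [set: U] (fun x => (f x ^+ n)^-1%R).
Proof.
move=> f0 mf; rewrite (_ : (fun x => _) = (fun x => f x `^ (- n%:R))%R).
  exact: (measurableT_comp (measurable_powR _) mf).
by apply/funext => x; rewrite powR_invn// ltW.
Qed.

Lemma measurable_bubble : measurable_fun [set: 'R[R]_n] bubble.
Proof.
apply: measurable_inv_pow.
  by move=> x; rewrite ltr_wpDr// sqr_ge0.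
by apply: measurable_funD => //; apply: measurable_funX; exact: measurable_enorm.
Qed.

Lemma radial_bubble u :
  radial (EFin \o bubble) u = (((1 + expR u ^+ 2) ^+ n)^-1)%:E.
Proof.
have v0 := @ball_volume_gt0 R n.
set r := expR u; have r0 : (0 < r)%R by exact: expR_gt0.
have r21 : (0 < 1 + r ^+ 2)%R by rewrite ltr_wpDr// sqr_ge0.
have b0 : (0 < ((1 + r ^+ 2) ^+ n)^-1)%R by rewrite invr_gt0 exprn_gt0.
rewrite /radial (_ : [set s | _] = `]0%R, (((1 + r ^+ 2) ^+ n)^-1)%R[%classic).
  by rewrite lebesgue_measure_itv/= lte_fin b0 oppr0 adde0.
have mB (s : R) : measurable [set x : 'R[R]_n | (0 < s)%R /\ s%:E < (bubble x)%:E].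
  rewrite (_ : [set x | _] = [set x | s%:E < (bubble x)%:E] `&`
    [set x | (0%:E < (cst s x)%:E)]); last first.
    by apply/seteqP; split=> x /= []; rewrite lte_fin.
  apply: measurableI; rewrite -[X in measurable X]setTI; apply: measurable_lte => //.
    by apply/measurable_EFinP; exact: measurable_bubble.
  by apply/measurable_EFinP; exact: measurable_cst.
have X0 := expball_volume_gt0 n u.
apply/seteqP; split=> s /=; rewrite in_itv/= /height.
  move=> us.
  have s0 : (0 < s)%R.
    rewrite ltNge; apply/negP => s0; move: us.
    rewrite (_ : [set x | _] = set0) ?measure0.
      by rewrite lte_fin => /lt_trans/(_ X0); rewrite ltxx.
    by apply/seteqP; split=> // x [s1 _]; move: (lt_le_trans s1 s0); rewrite ltxx.
  rewrite s0/= ltNge; apply/negP => sb.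
  move: us; rewrite ltNge => /negP; apply.
  rewrite expball_volumeE -(lebesgueRn_eball n r0).
  apply: le_measure; rewrite ?inE; [exact: mB|exact: measurable_eball|].
  move=> x /= [_]; rewrite lte_fin => /(le_lt_trans sb); rewrite /bubble.
  rewrite ltf_pV2 ?posrE ?exprn_gt0 ?(ltr_wpDr _ ltr01)// ?sqr_ge0//.
  rewrite ltr_pXn2r ?nnegrE ?(ltW r21)// ?addr_ge0 ?sqr_ge0//.
  by rewrite ltrD2l ltr_pXn2r// ?nnegrE ?enorm_ge0 ?(ltW r0)// => /ltW.
move=> /andP[s0 sb].
pose y := (s `^ (- n%:R^-1))%R.
have nR : (n%:R != 0 :> R)%R by rewrite pnatr_eq0 -lt0n.
have yn : (y ^+ n = s^-1)%R.
  rewrite -powR_mulrn ?powR_ge0// /y -powRrM mulNr mulVf// powR_inv1// ltW//.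
have yr : (1 + r ^+ 2 < y)%R.
  rewrite -(@ltr_pXn2r _ n)// ?nnegrE ?powR_ge0 ?(ltW r21)// yn.
  by rewrite -[ltLHS]invrK ltf_pV2 ?posrE.
(* At height s the superlevel set is the open ball of radius
   sqrt (y - 1) > r; q is a radius strictly between the two. *)
pose q := Num.sqrt ((y - 1 + r ^+ 2) / 2)%R.
have q2 : (q ^+ 2 = (y - 1 + r ^+ 2) / 2)%R.
  by rewrite sqr_sqrtr// divr_ge0// addr_ge0 ?sqr_ge0// subr_ge0; nra.
have q0 : (0 <= q)%R by exact: sqrtr_ge0.
have rq : (r < q)%R.
  by rewrite -(@ltr_pXn2r _ 2)// ?nnegrE ?(ltW r0)// q2; lra.
have qp := lt_trans r0 rq.
rewrite expball_volumeE; apply: (@lt_le_trans _ _ (v * q ^+ n)%:E).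
  by rewrite lte_fin ltr_pM2l// ltr_pXn2r// ?nnegrE ltW.
rewrite -(lebesgueRn_eball n qp).
apply: le_measure; rewrite ?inE; [exact: measurable_eball|exact: mB|].
move=> x /= xq; split=> //; rewrite lte_fin /bubble.
have x0 := enorm_ge0 x.
have xq2 : (enorm x ^+ 2 <= q ^+ 2)%R by rewrite ler_pXn2r ?nnegrE.
have xp : (0 < 1 + enorm x ^+ 2)%R by rewrite ltr_wpDr// sqr_ge0.
rewrite -[ltLHS]invrK ltf_pV2 ?posrE ?exprn_gt0 ?invr_gt0// -yn.
rewrite ltr_pXn2r ?nnegrE ?powR_ge0 ?(ltW xp)//.
by rewrite q2 in xq2; lra.
Qed.

Definition bubble_mass : \bar R := \int[lebesgueRn n]_x (bubble x)%:E.

(** The function n v (2 cosh u)^-n. *)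
Definition sech_profile (u : R) : R := (n%:R * v * ((expR u + expR (- u)) ^+ n)^-1)%R.

Lemma sech_profile_ge0 u : (0 <= sech_profile u)%R.
Proof.
by rewrite !mulr_ge0 ?ler0n ?(ltW (ball_volume_gt0 n))// invr_ge0 exprn_ge0// addr_ge0 ?expR_ge0.
Qed.

Lemma measurable_sech_profile : measurable_fun [set: T1] (sech_profile : T1 -> R).
Proof.
apply: measurable_funM => //; apply: measurable_inv_pow.
  by move=> x; rewrite addr_gt0 ?expR_gt0.
apply: measurable_funD; first exact: measurable_expR.
have mN : measurable_fun [set: T1] (fun x : T1 => - (x : R) : R)%R by exact: oppr_measurable.
exact: (measurableT_comp (@measurable_expR R) mN).
Qed.

Lemma bubble_massE : bubble_mass = \int[leb]_u (sech_profile u)%:E.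
Proof.
rewrite /bubble_mass (radial_layer_cake n_gt0 (F := EFin \o bubble)); last 2 first.
- by apply/measurable_EFinP; exact: measurable_bubble.
- by move=> x; rewrite lee_fin ltW// bubble_gt0.
apply: eq_integral => u _; rewrite radial_bubble -EFinM; congr EFin.
rewrite /expball_density expball_volumeE /sech_profile -!mulrA; congr (_ * (_ * _))%R.
rewrite -exprVn -exprMn -exprVn; congr (_ ^+ n)%R.
rewrite expRN; have := expR_gt0 u; set r := expR u => r0.
by field; rewrite !gt_eqF// ltr_wpDl// -expr2 sqr_ge0.
Qed.

(** The profile is even and, for u <= 0, at most the density of the volume of
    balls; since m is larger than the volume of the unit ball, the radii of
    the balls of volume smaller than m include all e^u with u <= 0. *)
Lemma bubble_mass_fin : bubble_mass = (fine bubble_mass)%:E /\ (0 < fine bubble_mass)%R.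
Proof.
have v0 := @ball_volume_gt0 R n.
have pos : 0 < bubble_mass.
  apply: (@lt_le_trans _ _ ((2 ^+ n)^-1 * v)%:E).
    by rewrite lte_fin mulr_gt0// invr_gt0 exprn_gt0.
  have i0 : (0 <= (2 ^+ n)^-1 :> R)%R by rewrite invr_ge0 exprn_ge0.
  have mE := measurable_eball 1 : measurable (@eball R n 1).
  have IE : lebesgueRn n (@eball R n 1) = \int[lebesgueRn n]_x (\1_(@eball R n 1) x)%:E.
    by rewrite integral_indic// setIT.
  rewrite EFinM -(ball_volume_fin n).1 IE.
  rewrite -ge0_integralZl_EFin//; last first.
    by apply/measurable_EFinP; exact: measurable_indic.
  apply: ge0_le_integral => //.
  - by apply: measurable_funeM; apply/measurable_EFinP; exact: measurable_indic.
  - by apply/measurable_EFinP; exact: measurable_bubble.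
  move=> x _; rewrite -EFinM lee_fin indicE.
  case: (boolP (_ \in _)) => [/set_mem x1|_]; last by rewrite mulr0 ltW// bubble_gt0.
  have xp : (0 < 1 + enorm x ^+ 2)%R by rewrite ltr_wpDr// sqr_ge0.
  rewrite mulr1 lef_pV2 ?posrE ?exprn_gt0//.
  rewrite ler_pXn2r ?nnegrE ?(ltW xp)//.
  have : (enorm x ^+ 2 <= 1 ^+ 2)%R by rewrite ler_pXn2r ?nnegrE ?enorm_ge0.
  by rewrite expr1n; lra.
have fin : bubble_mass < +oo.
  pose m : R := (v + 1)%R; have m0 : (0 < m)%R by rewrite addr_gt0.
  pose f (u : T1) := (expball_density n u)%:E *
    (\1_[set u : T1 | ((expball_volume n u)%:E < m%:E)%E] u)%:E.
  have mf : measurable_fun [set: T1] f by exact: measurable_density_below.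
  have f0 u : 0 <= f u by exact: density_below_ge0.
  have If : \int[leb]_u f u = m%:E by exact: integral_expball_density_EFin.
  have N1 : (-1 : R)%R != 0%R by rewrite oppr_eq0 oner_eq0.
  have mfN : measurable_fun [set: T1] (fun u : T1 => f (-1 * u + 0)%R).
    by apply: (measurableT_comp mf); exact: (measurable_affine (-1) 0).
  have IfN : \int[leb]_u f (-1 * u + 0)%R = m%:E.
    by rewrite -If (ge0_integral_affine 0 N1 mf f0) normrN1 mul1e.
  apply: (@le_lt_trans _ _ (\int[leb]_u (f u + f (-1 * u + 0)%R))); last first.
    by rewrite ge0_integralD// If IfN -EFinD ltry.
  rewrite bubble_massE; apply: ge0_le_integral => //.
  - by move=> u _; rewrite lee_fin sech_profile_ge0.
  - by apply/measurable_EFinP; exact: measurable_sech_profile.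
  - exact: emeasurable_funD.
  have half (u : R) : (u <= 0)%R -> (sech_profile u)%:E <= f u.
    move=> u0; rewrite /f indicE mem_set ?mule1 ?lee_fin; last first.
      rewrite /= lte_fin /m expball_volumeE -[ltLHS]addr0 ler_ltD//.
      rewrite -[leRHS]mulr1 ler_pM2l// exprn_ile1 ?expR_ge0//.
      by rewrite expR_le1.
    rewrite /sech_profile /expball_density expball_volumeE -mulrA.
    rewrite ler_pM2l ?ltr0n// ler_pM2l// -exprVn ler_pXn2r ?nnegrE ?invr_ge0 ?addr_ge0 ?expR_ge0//.
    rewrite -[leRHS]invrK lef_pV2 ?posrE ?invr_gt0 ?addr_gt0 ?expR_gt0//.
    by rewrite -expRN lerDr expR_ge0.
  move=> u _; have [u0|u0] := leP u 0%R.
    by rewrite (le_trans (half _ u0))// leeDl.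
  have -> : sech_profile u = sech_profile (- u).
    by rewrite /sech_profile opprK addrC.
  have Nu0 : (- u <= 0)%R by rewrite oppr_le0 ltW.
  by rewrite addr0 mulN1r (le_trans (half _ Nu0))// leeDr.
have finm : bubble_mass \is a fin_num by rewrite ge0_fin_numE// ltW.
by rewrite fineK// fine_gt0// pos fin.
Qed.

End endpoint.

(** * The sharp inequality for two integrals *)

Section conformal_product_le.
Context {R : realType}.
Local Notation T1 := (measurableTypeR R).
Local Notation leb := (@lebesgue_measure R).
Local Open Scope ereal_scope.
Context (n : nat) (n_gt0 : (0 < n)%N).
Local Notation v := (@ball_volume R n).

Lemma amgm_const_half : amgm_const (2^-1 : R) = 2%R.
Proof.
rewrite /amgm_const (_ : 1 - 2^-1 = 2^-1 :> R)%R; last by lra.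
rewrite -powRD; last by rewrite invr_eq0 pnatr_eq0 implybT.
by rewrite (_ : 2^-1 + 2^-1 = 1 :> R)%R ?powRr1 ?invrK//; lra.
Qed.

(** This is (e^u + e^w)^2 = 4 e^(u + w) cosh^2 ((u - w) / 2). *)
Lemma sech_profileB (u w : R) :
  (sech_profile n ((u - w) / 2) ^+ 2 =
   expball_density n u * expball_density n w / (expR u + expR w) ^+ (2 * n))%R.
Proof.
rewrite /sech_profile /expball_density !expball_volumeE.
set a := expR (u / 2); set b := expR (w / 2).
have uE : expR u = (a ^+ 2)%R by rewrite -expRM_natl mulrC divfK.
have wE : expR w = (b ^+ 2)%R by rewrite -expRM_natl mulrC divfK.
have -> : expR ((u - w) / 2) = (a / b)%R by rewrite mulrBl expRB.
have -> : expR (- ((u - w) / 2)) = (b / a)%R by rewrite -mulNr opprB mulrBl expRB.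
have a0 : (0 < a)%R by exact: expR_gt0.
have b0 : (0 < b)%R by exact: expR_gt0.
rewrite uE wE.
have -> : ((a / b + b / a) = (a ^+ 2 + b ^+ 2) / (a * b))%R.
  by field; rewrite !gt_eqF.
have c0 : (0 < a ^+ 2 + b ^+ 2)%R by rewrite addr_gt0// exprn_gt0.
rewrite [((_ / (a * b)) ^+ n)%R]expr_div_n [((a * b) ^+ n)%R]exprMn [((a ^+ 2) ^+ n)%R]exprAC.
rewrite [((b ^+ 2) ^+ n)%R]exprAC mulnC exprM.
have := exprn_gt0 n a0; have := exprn_gt0 n b0; have := exprn_gt0 n c0.
move: ((a ^+ 2 + b ^+ 2) ^+ n)%R (a ^+ n)%R (b ^+ n)%R => E P Q E0 Q0 P0.
by field; rewrite !gt_eqF.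
Qed.

(** The one-dimensional Prekopa-Leindler inequality with weight 1/2 is applied
    to the rearrangements in logarithmic radius, multiplied by the density of
    the volume; its hypothesis on a pair of radii e^u and e^w comes from
    [radius_sum_le] applied to two superlevel sets. *)
Lemma conformal_product_le (F G : 'R[R]_n -> R) (N : set ('R[R]_n * 'R[R]_n)) :
  measurable_fun [set: 'R[R]_n] F -> measurable_fun [set: 'R[R]_n] G ->
  (forall x, 0 <= F x)%R -> (forall x, 0 <= G x)%R ->
  measurable N -> (lebesgueRn n \x lebesgueRn n) N = 0 ->
  (forall x y, ~ N (x, y) -> F x * G y * Defs.edist x y ^+ (2 * n) <= 1)%R ->
  (\int[lebesgueRn n]_x (F x)%:E) * (\int[lebesgueRn n]_x (G x)%:E) <=
  (fine (@bubble_mass R n) ^+ 2)%:E.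
Proof.
move=> mF mG F0 G0 mN N0 FG.
have [bE bmass0] := @bubble_mass_fin R n n_gt0.
have mF' : measurable_fun [set: 'R[R]_n] (EFin \o F) by exact/measurable_EFinP.
have mG' : measurable_fun [set: 'R[R]_n] (EFin \o G) by exact/measurable_EFinP.
have F0' x : 0 <= (EFin \o F) x by rewrite lee_fin.
have G0' x : 0 <= (EFin \o G) x by rewrite lee_fin.
apply: mule_le_approx; last exact: sqr_ge0.
- by apply: integral_ge0 => x _; rewrite lee_fin.
- by apply: integral_ge0 => x _; rewrite lee_fin.
move=> s t s0 t0.
rewrite (radial_layer_cake n_gt0 mF' F0') (radial_layer_cake n_gt0 mG' G0') => sF tG.
pose Phi (X : 'R[R]_n -> R) (u : T1) : \bar R :=
  (expball_density n u)%:E * radial (EFin \o X) u.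
have mPhi X : measurable_fun [set: 'R[R]_n] (EFin \o X) ->
    measurable_fun [set: T1] (Phi X).
  move=> mX; apply: emeasurable_funM; last exact: measurable_radial.
  by apply/measurable_EFinP; exact: measurable_expball_density.
have Phi0 X u : 0 <= Phi X u.
  by rewrite mule_ge0// lee_fin ltW// expball_density_gt0.
pose H (z : T1) : \bar R := (sech_profile n (z / 2))%:E.
have mH : measurable_fun [set: T1] H.
  apply/measurable_EFinP.
  have mh : measurable_fun [set: T1] (fun z : T1 => (z : R) / 2 : T1)%R.
    by apply: measurable_funM.
  exact: (measurableT_comp (@measurable_sech_profile R n) mh).
have H0 z : 0 <= H z by rewrite lee_fin sech_profile_ge0.
have half01 : (0 < (2^-1 : R) < 1)%R by lra.
have key (u w : T1) : ~ (set0 : set (T1 * T1)) (u, w) ->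
    geometric_le 2^-1 1 (Phi F u) (Phi G w) (H (u - w)%R).
  move=> _ a b a0 b0 aF bG.
  have du := @expball_density_gt0 R n n_gt0 u.
  have dw := @expball_density_gt0 R n n_gt0 w.
  have a0' : (0 < a / expball_density n u)%R by rewrite divr_gt0.
  have b0' : (0 < b / expball_density n w)%R by rewrite divr_gt0.
  have [s' [as' us']] : exists s', (a / expball_density n u <= s')%R /\
      (expball_volume n u)%:E < lebesgueRn n [set x | s'%:E < (F x)%:E].
    by apply: (lt_radial_exists mF') => //; rewrite mulrC EFinM lte_pdivrMl.
  have [t' [bt' wt']] : exists t', (b / expball_density n w <= t')%R /\
      (expball_volume n w)%:E < lebesgueRn n [set x | t'%:E < (G x)%:E].
    by apply: (lt_radial_exists mG') => //; rewrite mulrC EFinM lte_pdivrMl.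
  have s'0 := lt_le_trans a0' as'; have t'0 := lt_le_trans b0' bt'.
  pose d := ((s' * t') `^ (- (2 * n)%:R^-1))%R.
  have d0 : (0 < d)%R by rewrite powR_gt0// mulr_gt0.
  have nR : ((2 * n)%:R != 0 :> R)%R by rewrite pnatr_eq0 -lt0n muln_gt0.
  have dn : (d ^+ (2 * n) = (s' * t')^-1)%R.
    rewrite -powR_mulrn ?powR_ge0// /d -powRrM mulNr mulVf// powR_inv1//.
    by rewrite ltW// mulr_gt0.
  have rq : (expR u + expR w <= d)%R.
    apply: (@radius_sum_le R n [set x | s'%:E < (F x)%:E]
      [set x | t'%:E < (G x)%:E] N) => //.
    - exact: expR_gt0.
    - exact: expR_gt0.
    - exact: measurable_superlevel mF'.
    - exact: measurable_superlevel mG'.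
    - move=> x y /=; rewrite !lte_fin => Fx Gy /FG FGxy.
      have e0 : (0 <= Defs.edist x y)%R by exact: sqrtr_ge0.
      rewrite -(@ler_pXn2r _ (2 * n)) ?nnegrE ?(ltW d0)// ?muln_gt0// dn.
      rewrite -[leRHS]mulr1 ler_pdivlMl ?mulr_gt0//.
      apply: le_trans FGxy; apply: ler_wpM2r; first exact: exprn_ge0.
      by apply: ler_pM; rewrite ?ltW.
    - by rewrite -expball_volumeE.
    - by rewrite -expball_volumeE.
  have c0 : (0 < expR u + expR w)%R by rewrite addr_gt0 ?expR_gt0.
  rewrite lee_fin mul1r -(@ler_pXn2r _ 2) ?nnegrE ?sech_profile_ge0 ?mulr_ge0 ?powR_ge0//.
  rewrite sech_profileB exprMn.
  have sq (x w' : R) : (0 < x)%R -> w' = 2^-1%R -> ((x `^ w') ^+ 2 = x)%R.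
    by move=> x0 ->; rewrite powR12_sqrt ?sqr_sqrtr// ltW.
  rewrite !sq//; last by lra.
  rewrite ler_pdivlMr ?exprn_gt0//.
  apply: (@le_trans _ _ (a * b * d ^+ (2 * n))%R).
    by rewrite ler_pM2l ?mulr_gt0// ler_pXn2r ?nnegrE ?(ltW c0) ?(ltW d0) ?muln_gt0.
  rewrite dn ler_pdivrMr ?mulr_gt0// mulrACA.
  apply: ler_pM; rewrite ?(ltW a0) ?(ltW b0)//.
    by rewrite mulrC -ler_pdivrMr.
  by rewrite mulrC -ler_pdivrMr.
have := prekopa_leindler_1d half01 ltr01 (mPhi _ mF') (mPhi _ mG') mH (Phi0 _)
  (Phi0 _) H0 measurable0 (measure0 _) key s0 t0 sF tG.
(* The factor 2 of the substitution z = 2 x in the integral of H cancels the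
   constant 2 of the arithmetic-geometric inequality of weight 1/2. *)
have c20 : (2%R != 0 :> R)%R by rewrite pnatr_eq0.
rewrite (ge0_integral_affine 0 c20 mH H0) amgm_const_half ger0_norm//.
rewrite (_ : \int[leb]_x H _ = bubble_mass n); last first.
  rewrite (bubble_massE n_gt0); apply: eq_integral => x _.
  by rewrite /H addr0 mulrC mulKf.
rewrite bE -EFinM lee_fin mulr1 ler_pM2l// => le.
have : ((s `^ (1 - 2^-1) * t `^ 2^-1) ^+ 2 <= fine (bubble_mass n) ^+ 2)%R.
  by rewrite ler_pXn2r// nnegrE ?mulr_ge0 ?powR_ge0 ?ltW.
rewrite exprMn (_ : 1 - 2^-1 = 2^-1 :> R)%R; last by lra.
by rewrite !powR12_sqrt ?(ltW s0) ?(ltW t0)// !sqr_sqrtr ?(ltW s0) ?(ltW t0).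
Qed.

End conformal_product_le.

(** * The sharp inequality in L^p *)

Section endpoint_Lp.
Context {R : realType}.
Local Notation T1 := (measurableTypeR R).
Context (n : nat) (p : R) (n_gt0 : (0 < n)%N) (p_gt0 : 0 < p).
Local Notation mu := (@lebesgueRn R n).

(** With Y = |y|^2 > 0, the coordinates a of x and b of y satisfy
    (a - b)^2 <= (1 + Y) a^2 + (1 + 1 / Y) b^2, because the difference is
    (Y a + b)^2 / Y, and the terms b^2 / Y add up to 1. If Y = 0, every b
    vanishes. *)
Lemma edist_sqr_le (x y : 'R[R]_n) :
  Defs.edist x y ^+ 2 <= (1 + enorm x ^+ 2) * (1 + enorm y ^+ 2).
Proof.
set Y := enorm y ^+ 2; have Y0 : 0 <= Y by exact: sqr_ge0.
rewrite edistE [enorm (tuple_sub x y) ^+ 2]sqr_enorm.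
apply: (@le_trans _ _ (\sum_(i < n) ((1 + Y) * (tnth x i : R) ^+ 2 +
    (1 + Y^-1) * (tnth y i : R) ^+ 2))).
  apply: ler_sum => i _; rewrite tnth_mktuple.
  set a := (tnth x i : R); set b := (tnth y i : R).
  have bY : b ^+ 2 <= Y.
    by rewrite /Y sqr_enorm (bigD1 i)//= lerDl sumr_ge0// => j _; exact: sqr_ge0.
  have [Y00|Yn] := eqVneq Y 0.
    have b0 : b = 0.
      by apply/eqP; rewrite -sqrf_eq0 eq_le sqr_ge0 andbT -Y00.
    by rewrite b0 Y00 invr0 expr0n/= subr0 addr0 mul1r mulr0 addr0.
  have Yp : 0 < Y by rewrite lt0r Yn.
  rewrite -subr_ge0.
  have -> : (1 + Y) * a ^+ 2 + (1 + Y^-1) * b ^+ 2 - (a - b) ^+ 2 =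
    (Y * a + b) ^+ 2 / Y by field.
  by rewrite divr_ge0// sqr_ge0.
rewrite big_split/= -!mulr_sumr -!sqr_enorm -/Y.
have [->|Yn] := eqVneq Y 0; first by rewrite invr0; have := sqr_ge0 (enorm x); lra.
by rewrite !mulrDl !mul1r mulVf//; have := sqr_ge0 (enorm x); nra.
Qed.

Lemma Lp_normE (f : 'R[R]_n -> R) : (forall x, 0 <= f x) ->
  Lp_norm p f = ((\int[mu]_x (f x `^ p)%:E) `^ p^-1)%E.
Proof.
move=> f0; rewrite /Lp_norm unlock; congr (_ `^ _)%E.
by apply: eq_integral => x _; rewrite /= ger0_norm.
Qed.

Definition sharp_constant : R := fine (@bubble_mass R n) `^ (2 / p).

Lemma sharp_constant_gt0 : 0 < sharp_constant.
Proof. by rewrite powR_gt0//; exact: (bubble_mass_fin n_gt0).2. Qed.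

Lemma lebesgueRn_setT_gt0 : (0 < (mu \x mu) setT)%E.
Proof.
have m0 : (0 < mu setT)%E.
  apply: (@lt_le_trans _ _ (mu (@eball R n 1))).
    by rewrite (ball_volume_fin n).1 lte_fin ball_volume_gt0.
  by apply: le_measure; rewrite ?inE//; exact: measurable_eball.
by rewrite -setXTT product_measure1E// mule_gt0.
Qed.

(** [conformal_product_le] applied to (f / k)^p and g^p. *)
Lemma Lp_norm_mul_le (f g : 'R[R]_n -> R) (k : R) : 0 < k ->
  Lp_ge0 p f -> Lp_ge0 p g -> (ess_sup_weighted p f g <= k%:E)%E ->
  (Lp_norm p f * Lp_norm p g <= (sharp_constant * k)%:E)%E.
Proof.
move=> k0 [fL f0] [gL g0] /ess_supP[N [mN N0 fgN]].
have mf : measurable_fun setT f := set_mem (sub_Lfun_mfun fL).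
have mg : measurable_fun setT g := set_mem (sub_Lfun_mfun gL).
have [bE bmass0] := @bubble_mass_fin R n n_gt0.
have kp : 0 < k `^ p by rewrite powR_gt0.
have kpV : 0 <= (k `^ p)^-1 by rewrite invr_ge0 ltW.
have mpow (h : 'R[R]_n -> R) :
    measurable_fun setT h -> measurable_fun setT (fun x => h x `^ p).
  by move=> mh; exact: (measurableT_comp (measurable_powR p) mh).
have := @conformal_product_le R n n_gt0 (fun x => (k `^ p)^-1 * f x `^ p)
  (fun x => g x `^ p) N.
move=> /(_ _ _ _ _ mN N0 _) L1.
have {}L1 : (\int[mu]_x ((k `^ p)^-1 * f x `^ p)%:E * \int[mu]_x (g x `^ p)%:E <=
    (fine (bubble_mass n) ^+ 2)%:E)%E.
  apply: L1.
  - by apply: measurable_funM => //; exact: mpow.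
  - exact: mpow.
  - by move=> x; rewrite mulr_ge0// powR_ge0.
  - by move=> x; rewrite powR_ge0.
  move=> x y Nxy.
  have : ((f x * g y * Defs.edist x y `^ (2 * n%:R / p))%:E <= k%:E)%E.
    by apply: contrapT => h; apply: Nxy; apply: fgN.
  rewrite lee_fin => fgk.
  have e0 : 0 <= Defs.edist x y by exact: sqrtr_ge0.
  have -> : Defs.edist x y ^+ (2 * n) = (Defs.edist x y `^ (2 * n%:R / p)) `^ p.
    by rewrite -powRrM divfK ?gt_eqF// -natrM powR_mulrn.
  rewrite -!mulrA ler_pdivrMl// mulr1 mulrA -!powRM ?mulr_ge0 ?powR_ge0//.
  apply: ge0_ler_powR; rewrite ?nnegrE ?(ltW p_gt0) ?(ltW k0) ?mulr_ge0 ?powR_ge0//.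
  by move: fgk; rewrite -!mulrA.
rewrite !Lp_normE// -poweRM; last 2 first.
- by apply: integral_ge0 => x _; rewrite lee_fin powR_ge0.
- by apply: integral_ge0 => x _; rewrite lee_fin powR_ge0.
have le : (\int[mu]_x (f x `^ p)%:E * \int[mu]_x (g x `^ p)%:E <=
    (k `^ p * fine (bubble_mass n) ^+ 2)%:E)%E.
  rewrite [leRHS]EFinM -lee_pdivrMl// muleA.
  suff -> : ((k `^ p)^-1%:E * \int[mu]_x (f x `^ p)%:E =
    \int[mu]_x ((k `^ p)^-1 * f x `^ p)%:E)%E by [].
  rewrite -ge0_integralZl_EFin//.
  - by move=> x _; rewrite lee_fin powR_ge0.
  - by apply/measurable_EFinP; exact: mpow.
have pV : 0 <= p^-1 by rewrite invr_ge0 ltW.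
apply: (le_trans (gt0_ler_poweR pV _ _ le)).
- rewrite in_itv/= leey andbT mule_ge0//; apply: integral_ge0 => x _.
    by rewrite lee_fin powR_ge0.
  by rewrite lee_fin powR_ge0.
- by rewrite in_itv/= leey andbT lee_fin mulr_ge0// ?sqr_ge0// ltW.
rewrite poweR_EFin lee_fin powRM ?sqr_ge0 ?powR_ge0// -powRrM divff ?gt_eqF//.
rewrite powRr1 ?(ltW k0)// mulrC /sharp_constant -powR_mulrn ?(ltW bmass0)//.
by rewrite -powRrM.
Qed.

(** The bound of [Lp_norm_mul_le] requires a positive k, whereas the essential
    supremum may vanish, so it is approached from above. *)
Lemma sharp_constant_holds : holds_with_constant n p sharp_constant.
Proof.
move=> f g fL gL.
have C0 := sharp_constant_gt0.
have E0 : (0 <= ess_sup_weighted p f g)%E.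
  apply: ess_sup_gee; first exact: lebesgueRn_setT_gt0.
  apply: aeW => z; rewrite lee_fin mulr_ge0 ?powR_ge0// mulr_ge0//.
    exact: fL.2.
  exact: gL.2.
case E : (ess_sup_weighted p f g) E0 => [r| |]//; last first.
  by move=> _; rewrite gt0_muley ?lte_fin// leey.
rewrite lee_fin => r0; apply/lee_addgt0Pr => e e0.
have eC : 0 < e / sharp_constant by rewrite divr_gt0.
have := @Lp_norm_mul_le f g (r + e / sharp_constant) (ltr_wpDl r0 eC) fL gL.
rewrite E lee_fin lerDl ltW// => /(_ isT).
by rewrite mulrDr mulrC [X in _ + X]mulrC divfK ?gt_eqF// mulrC EFinD EFinM.
Qed.

Lemma extremizer_powR (x : 'R[R]_n) : extremizer p x `^ p = bubble x.
Proof.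
rewrite /extremizer -powRrM mulNr divfK ?gt_eqF// powR_invn//.
by rewrite addr_ge0// sqr_ge0.
Qed.

Lemma measurable_extremizer : measurable_fun [set: 'R[R]_n] (extremizer p).
Proof.
have mq : measurable_fun [set: 'R[R]_n] (fun x => 1 + enorm x ^+ 2).
  by apply: measurable_funD => //; apply: measurable_funX; exact: measurable_enorm.
exact: (measurableT_comp (measurable_powR _) mq).
Qed.

Section scaled_extremizer.
Context (c : R) (c0 : 0 < c).
Let f (x : 'R[R]_n) : R := c * extremizer p x.

Let f_ge0 x : 0 <= f x.
Proof. by rewrite mulr_ge0 ?powR_ge0// ltW. Qed.

Lemma Lp_norm_extremizer : Lp_norm p f = (c * fine (@bubble_mass R n) `^ p^-1)%:E.
Proof.
have [bE bmass0] := @bubble_mass_fin R n n_gt0.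
rewrite Lp_normE//.
have -> : (\int[mu]_x (f x `^ p)%:E = (c `^ p * fine (bubble_mass n))%:E)%E.
  rewrite EFinM -bE -ge0_integralZl_EFin ?powR_ge0//; last 2 first.
  - by move=> x _; rewrite lee_fin ltW// bubble_gt0.
  - by apply/measurable_EFinP; exact: measurable_bubble.
  apply: eq_integral => x _; rewrite -EFinM; congr EFin.
  by rewrite powRM ?powR_ge0 ?(ltW c0)// extremizer_powR.
rewrite poweR_EFin powRM ?powR_ge0 ?(ltW bmass0)// -powRrM divff ?gt_eqF//.
by rewrite powRr1 ?(ltW c0).
Qed.

Lemma Lp_ge0_extremizer : Lp_ge0 p f.
Proof.
split => //; apply/andP; split; rewrite inE/=.
  by apply: measurable_funM => //; exact: measurable_extremizer.
by rewrite /finite_norm -/(Lp_norm p f) Lp_norm_extremizer ltry.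
Qed.

End scaled_extremizer.

(** The upper bound holds pointwise by [edist_sqr_le]. The lower bound follows
    from the sharp inequality, whose left-hand side is known here: no set of
    almost maximising pairs has to be exhibited. *)
Lemma ess_sup_extremizer (c1 c2 : R) : 0 < c1 -> 0 < c2 ->
  ess_sup_weighted p (fun x : 'R[R]_n => c1 * extremizer p x)
    (fun x : 'R[R]_n => c2 * extremizer p x) = (c1 * c2)%:E.
Proof.
move=> c10 c20; set f := (fun x => _); set g := (fun x => c2 * _).
have C0 := sharp_constant_gt0.
have [bE bmass0] := @bubble_mass_fin R n n_gt0.
apply/eqP; rewrite eq_le; apply/andP; split.
  apply/ess_supP; apply: aeW => -[x y] /=; rewrite lee_fin /f /g.
  have -> : c1 * extremizer p x * (c2 * extremizer p y) *
      Defs.edist x y `^ (2 * n%:R / p) = c1 * c2 *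
      (extremizer p x * extremizer p y * Defs.edist x y `^ (2 * n%:R / p)) by ring.
  apply: ler_piMr; first by rewrite mulr_ge0 ?(ltW c10) ?(ltW c20).
  have x0 : 0 < 1 + enorm x ^+ 2 by rewrite ltr_wpDr// sqr_ge0.
  have y0 : 0 < 1 + enorm y ^+ 2 by rewrite ltr_wpDr// sqr_ge0.
  have e0 : 0 <= Defs.edist x y by exact: sqrtr_ge0.
  rewrite /extremizer -powRM ?(ltW x0) ?(ltW y0)// powRN.
  rewrite ler_pdivrMl ?powR_gt0 ?mulr_gt0// mulr1 -mulrA powRrM.
  rewrite powR_mulrn//; apply: ge0_ler_powR.
  - by rewrite divr_ge0// ltW.
  - by rewrite nnegrE sqr_ge0.
  - by rewrite nnegrE mulr_ge0 ?ltW.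
  exact: edist_sqr_le.
have := sharp_constant_holds (Lp_ge0_extremizer c10) (Lp_ge0_extremizer c20).
rewrite !Lp_norm_extremizer// -EFinM mulrACA -powRD; last first.
  by rewrite (gt_eqF bmass0) implybT.
rewrite -mulr2n -mulr_natl -/sharp_constant mulrC EFinM.
by rewrite lee_pmul2l// lte_fin.
Qed.

End endpoint_Lp.

Theorem theorem4p1 (R : realType) (n : nat) (p : R)
    (hn : (1 <= n)%N) (hp : 0 < p) :
  exists C : R,
    [/\ holds_with_constant n p C,
        forall C' : R, holds_with_constant n p C' -> C <= C'
      & forall c1 c2 : R, 0 < c1 -> 0 < c2 ->
          let f := fun x : 'R[R]_n => c1 * extremizer p x in
          let g := fun x : 'R[R]_n => c2 * extremizer p x in
          [/\ Lp_ge0 p f, Lp_ge0 p g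
            & (Lp_norm p f * Lp_norm p g = C%:E * ess_sup_weighted p f g)%E]].
Proof.
have equality (c1 c2 : R) : 0 < c1 -> 0 < c2 ->
    (Lp_norm p (fun x : 'R[R]_n => c1 * extremizer p x)%R *
     Lp_norm p (fun x : 'R[R]_n => c2 * extremizer p x)%R =
     (sharp_constant n p * (c1 * c2))%:E)%E.
  move=> c10 c20; rewrite !Lp_norm_extremizer// -EFinM mulrACA -powRD; last first.
    by rewrite (gt_eqF (bubble_mass_fin hn).2) implybT.
  by rewrite -mulr2n -mulr_natl mulrC.
exists (sharp_constant n p); split.
- exact: sharp_constant_holds.
- move=> C' /(_ _ _ (Lp_ge0_extremizer hn hp ltr01) (Lp_ge0_extremizer hn hp ltr01)).
  by rewrite equality// ess_sup_extremizer// -EFinM lee_fin !mulr1.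
- move=> c1 c2 c10 c20 f g; split; [exact: Lp_ge0_extremizer|exact: Lp_ge0_extremizer|].
  by rewrite equality// ess_sup_extremizer// -EFinM.
Qed.
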